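(* Let $(H,B)$ be a Hopf admissible pair over a field $k$ (equivalently, $H$ is a Hopf algebra with bijective antipode and $B$ is a Hopf algebra in ${}_H^H\mathcal{YD}$), and let $B\times H$ be the Radford biproduct. (i) For a normalized left 2-cocycle $\sigma:B\otimes B\to k$ in ${}_H^H\mathcal{YD}$ define $\overline{\sigma}:(B\times H)\otimes(B\times H)\to k$ by $$\overline{\sigma}(b\times h,b'\times h')=\sigma(b\otimes h\cdot b')\,\varepsilon(h').$$ Then $\overline{\sigma}$ is a normalized left 2-cocycle on $B\times H$ and ${}_{\sigma}B\# H={}_{\overline{\sigma}}(B\times H)$ as algebras (on $B\otimes H$). Moreover, $\overline{\sigma}$ is the unique normalized left 2-cocycle on $B\times H$ with this property. (ii) If $\sigma$ is convolution invertible in ${}_H^H\mathcal{YD}$, with convolution inverse $\sigma^{-1}$ in ${}_H^H\mathcal{YD}$, then $\overline{\sigma}$ is convolution invertible, with inverse $\overline{\sigma}^{-1}(b\times h,b'\times h')=\sigma^{-1}(b\otimes h\cdot b')\varepsilon(h')$. (iii) If $\sigma$ is lazy in ${}_H^H\mathcal{YD}$, then $\overline{\sigma}$ is lazy. (iv) If $\sigma,\tau:B\otimes B\to k$ are lazy 2-cocycles in ${}_H^H\mathcal{YD}$, then $\overline{\sigma*\tau}=\overline{\sigma}*\overline{\tau}$; hence $\sigma\mapsto\overline{\sigma}$ is a group homomorphism from $Z^2_L(B)$ to $Z^2_L(B\times H)$. (v) If $\gamma:B\to k$ is a normalized and convolution invertible morphism in ${}_H^H\mathcal{YD}$, define $\overline{\gamma}:B\times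 H\to k$ by $\overline{\gamma}(b\times h)=\gamma(b)\varepsilon(h)$. Then $\overline{\gamma}$ is normalized and convolution invertible and $\overline{D^1(\gamma)}=D^1(\overline{\gamma})$. If $\gamma$ is lazy in ${}_H^H\mathcal{YD}$, then $\overline{\gamma}$ is also lazy. (vi) If $\sigma$ is a lazy 2-coboundary for $B$ in ${}_H^H\mathcal{YD}$, then $\overline{\sigma}$ is a lazy 2-coboundary for $B\times H$, so the group homomorphism $Z^2_L(B)\to Z^2_L(B\times H)$, $\sigma\mapsto\overline{\sigma}$, factorizes to a group homomorphism $H^2_L(B)\to H^2_L(B\times H)$.
   Context: Sweedler notation $\Delta(h)=h_1\otimes h_2$, $\Delta_B(b)=b_1\otimes b_2$. Hopf algebras $H$ have bijective antipode. Admissible pair. $H$ is a bialgebra, $B$ is an algebra and a coalgebra $(B,\Delta_B,\varepsilon_B)$ with a left $H$-action $h\otimes b\mapsto h\cdot b$ and left $H$-coaction $b\mapsto b^{(-1)}\otimes b^{(0)}$ such that $B$ is a left $H$-module algebra, left $H$-comodule algebra, left $H$-comodule coalgebra, left $H$-module coalgebra; $\varepsilon_B$ is an algebra map and $\Delta_B(1_B)=1_B\otimes 1_B$; and $\Delta_B(bc)=b_1(b_2^{(-1)}\cdot c_1)\otimes b_2^{(0)}c_2$ and $(h_1\cdot b)^{(-1)}h_2\otimes(h_1\cdot b)^{(0)}=h_1b^{(-1)}\otimes h_2\cdot b^{(0)}$. It is a Hopf admissible pair if moreover $H$ is a Hopf algebra and $\mathrm{id}_B$ has a convolution inverse in $\mathrm{Hom}(B,B)$.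 The Radford biproduct $B\times H$ is the Hopf algebra on $B\otimes H$ with product $(b\times h)(b'\times h')=b(h_1\cdot b')\times h_2h'$, unit $1\times 1$, comultiplication $\Delta(b\times h)=(b_1\times b_2^{(-1)}h_1)\otimes(b_2^{(0)}\times h_2)$, counit $\varepsilon_B\otimes\varepsilon_H$. Notions for an ordinary Hopf algebra $K$. A linear map $\sigma:K\otimes K\to k$ is normalized if $\sigma(1,h)=\sigma(h,1)=\varepsilon(h)$; a left 2-cocycle if $\sigma(a_1,b_1)\sigma(a_2b_2,c)=\sigma(b_1,c_1)\sigma(a,b_2c_2)$; lazy if $\sigma(h_1,h'_1)h_2h'_2=\sigma(h_2,h'_2)h_1h'_1$. For a normalized left 2-cocycle, ${}_\sigma K$ is $K$ with product $h\cdot_\sigma h'=\sigma(h_1,h'_1)h_2h'_2$. A linear $\gamma:K\to k$ is normalized if $\gamma(1)=1$, lazy if $\gamma(h_1)h_2=h_1\gamma(h_2)$; for $\gamma$ normalized and convolution invertible, $D^1(\gamma)(h,h')=\gamma(h_1)\gamma(h'_1)\gamma^{-1}(h_2h'_2)$. $Z^2_L(K)$ is the group (under convolution) of normalized convolution invertible lazy left 2-cocycles; $B^2_L(K)$ (lazy 2-coboundaries) is the central subgroup of the $D^1(\gamma)$ with $\gamma$ normalized, convolution invertible and lazy; $H^2_L(K)=Z^2_L(K)/B^2_L(K)$. Notions for $B$ in ${}_H^H\mathcal{YD}$ (left-left Yetter-Drinfeld modules, braiding $m\otimes n\mapsto m_{<-1>}\cdot n\otimes m_{<0>}$). A linear map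 $\sigma:B\otimes B\to k$ is a morphism in ${}_H^H\mathcal{YD}$ iff $\sigma(h_1\cdot b\otimes h_2\cdot b')=\varepsilon(h)\sigma(b\otimes b')$ and $\sigma(b^{(0)}\otimes b'^{(0)})b^{(-1)}b'^{(-1)}=\sigma(b\otimes b')1_H$; a linear map $\gamma:B\to k$ is a morphism iff $\gamma(h\cdot b)=\varepsilon(h)\gamma(b)$ and $\gamma(b^{(0)})b^{(-1)}=\gamma(b)1_H$. The convolution of morphisms $\sigma,\tau:B\otimes B\to k$ in ${}_H^H\mathcal{YD}$ is $(\sigma*\tau)(b\otimes b')=\sigma(b_1\otimes b_2^{(-1)}\cdot b'_1)\tau(b_2^{(0)}\otimes b'_2)$ (with unit $\varepsilon_B\otimes\varepsilon_B$); for morphisms $B\to k$ it is the usual convolution. Convolution invertible in ${}_H^H\mathcal{YD}$ means having an inverse that is also a morphism in ${}_H^H\mathcal{YD}$. Normalized means $\sigma(1\otimes b)=\sigma(b\otimes 1)=\varepsilon_B(b)$, respectively $\gamma(1)=1$. A normalized left 2-cocycle in ${}_H^H\mathcal{YD}$ is a normalized morphism $\sigma:B\otimes B\to k$ with $\sigma(a_1\otimes a_2^{(-1)}\cdot b_1)\sigma(a_2^{(0)}b_2\otimes c)=\sigma(b_1\otimes b_2^{(-1)}\cdot c_1)\sigma(a\otimes b_2^{(0)}c_2)$. It is lazy if $\sigma(b_1\otimes b_2^{(-1)}\cdot b'_1)b_2^{(0)}b'_2=\sigma(b_2^{(0)}\otimes b'_2)b_1(b_2^{(-1)}\cdot b'_1)$.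 A morphism $\gamma:B\to k$ is lazy if $\gamma(b_1)b_2=b_1\gamma(b_2)$. For $\gamma$ a normalized convolution invertible morphism, $D^1(\gamma)(b\otimes b')=\gamma(b_1)\gamma(b'_1)\gamma^{-1}(b_2b'_2)$, and $\overline{D^1(\gamma)}$ is defined by the same formula as $\overline{\sigma}$ in (i). $Z^2_L(B)$ is the group under $*$ of normalized, convolution invertible lazy left 2-cocycles in ${}_H^H\mathcal{YD}$, $B^2_L(B)$ (lazy 2-coboundaries) its subgroup of the $D^1(\gamma)$ with $\gamma$ a lazy normalized convolution invertible morphism, and $H^2_L(B)=Z^2_L(B)/B^2_L(B)$. For a normalized left 2-cocycle $\sigma$ in ${}_H^H\mathcal{YD}$, ${}_\sigma B$ is the algebra in ${}_H^H\mathcal{YD}$ on $B$ with product $b\cdot b'=\sigma(b_1\otimes b_2^{(-1)}\cdot b'_1)b_2^{(0)}b'_2$; in particular it is a left $H$-module algebra, and ${}_\sigma B\# H$ is the usual smash product. *)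

(* Defs.v *)
From HB Require Import structures.
From mathcomp Require Import all_boot all_order all_algebra.
From mathcomp Require Import boolp classical_sets.

Set Implicit Arguments.
Unset Strict Implicit.
Unset Printing Implicit Defensive.

Import GRing.Theory.
Local Open Scope quotient_scope.
Local Open Scope classical_set_scope.
Local Open Scope ring_scope.

Declare Scope tensor_scope.
Open Scope tensor_scope.

(* Tensor product of two modules: formal sums of pure tensors, two of them
   being identified when no bilinear map separates them.  The scalars are
   absorbed in the left factor.  The lemmas of this section show that this is
   the usual tensor product: [tens] is bilinear, pure tensors span, and each
   bilinear map [f] factors uniquely through the linear map
   [fun t => \tsum_(u, v <- t) f u v]. *)

Local Notation bilin f := (bilinear_for *:%R *:%R f).

Section Tensor.
Variables (R : comNzRingType) (U V : lmodType R).

Definition formal_eval (W : nmodType) (f : U -> V -> W) (s : seq (U * V)) : W :=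
  \sum_(p <- s) f p.1 p.2.

Definition tensor_rel (s t : seq (U * V)) : bool :=
  `[< forall (W : lmodType R) (f : U -> V -> W),
        bilin f -> formal_eval f s = formal_eval f t >].

Lemma tensor_rel_refl : reflexive tensor_rel.
Proof. by move=> s; apply/asboolP. Qed.

Lemma tensor_rel_sym : symmetric tensor_rel.
Proof.
by move=> s t; apply/asboolP/asboolP => st W f fl; rewrite st.
Qed.

Lemma tensor_rel_trans : transitive tensor_rel.
Proof.
move=> t s r /asboolP st /asboolP tr; apply/asboolP => W f fl.
by rewrite st ?tr.
Qed.

Canonical tensor_equiv :=
  EquivRel tensor_rel tensor_rel_refl tensor_rel_sym tensor_rel_trans.

Definition tensor : Type := {eq_quot tensor_rel}.

HB.instance Definition _ := Choice.on tensor.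
HB.instance Definition _ := EqQuotient.on tensor.

Lemma tensorP (s t : seq (U * V)) :
  (forall (W : lmodType R) (f : U -> V -> W),
     bilin f -> formal_eval f s = formal_eval f t) <->
  \pi_tensor s = \pi_tensor t.
Proof.
by split => [st|/eqP]; [apply/eqP; rewrite piE; apply/asboolP|
  rewrite piE => /asboolP].
Qed.

(* Sweedler sum: applied to a bilinear [f] it is the value at [t] of the linear
   map induced by [f]; for other [f] it depends on the chosen representative. *)
Definition tsum (W : nmodType) (t : tensor) (f : U -> V -> W) : W :=
  formal_eval f (repr t).

Definition tens (u : U) (v : V) : tensor := \pi_tensor [:: (u, v)].

Lemma tsum_pi (W : lmodType R) (f : U -> V -> W) s :
  bilin f -> tsum (\pi_tensor s) f = formal_eval f s.
Proof.
by move=> fl; rewrite /tsum; apply: (tensorP _ _).2 => //; rewrite reprK.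
Qed.

Lemma tensor_ext (x y : tensor) :
  (forall (W : lmodType R) (f : U -> V -> W), bilin f -> tsum x f = tsum y f) ->
  x = y.
Proof. by move=> xy; rewrite -[x]reprK -[y]reprK; apply/tensorP. Qed.

Definition tensor_zero : tensor := \pi_tensor [::].
Definition tensor_add (x y : tensor) : tensor := \pi_tensor (repr x ++ repr y).
Definition tensor_scale (a : R) (x : tensor) : tensor :=
  \pi_tensor [seq (a *: p.1, p.2) | p <- repr x].
Definition tensor_opp (x : tensor) : tensor := tensor_scale (-1) x.

Section Eval.
Variables (W : lmodType R) (f : U -> V -> W).
Hypothesis fl : bilin f.

Let fDl u u' v : f (u + u') v = f u v + f u' v.
Proof. by have /= := fl.1 v 1 u u'; rewrite !scale1r => ->. Qed.
Let f0l v : f 0 v = 0.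
Proof. by have := fDl 0 0 v; rewrite addr0 -{1}[f 0 v]addr0 => /addrI <-. Qed.
Let fZl a u v : f (a *: u) v = a *: f u v.
Proof. by have /= := fl.1 v a u 0; rewrite !addr0 f0l addr0. Qed.

Lemma tsum0 : tsum tensor_zero f = 0.
Proof. by rewrite tsum_pi // /formal_eval big_nil. Qed.

Lemma tsum_add x y : tsum (tensor_add x y) f = tsum x f + tsum y f.
Proof. by rewrite tsum_pi // /formal_eval big_cat. Qed.

Lemma tsum_scale a x : tsum (tensor_scale a x) f = a *: tsum x f.
Proof.
rewrite tsum_pi // /formal_eval big_map scaler_sumr.
by apply: eq_bigr => p _ /=; rewrite fZl.
Qed.

Lemma tsum_tens u v : tsum (tens u v) f = f u v.
Proof. by rewrite tsum_pi // /formal_eval big_seq1. Qed.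

End Eval.

Fact tensor_addA : associative tensor_add.
Proof. by move=> x y z; apply: tensor_ext => W f fl; rewrite !tsum_add // addrA. Qed.
Fact tensor_addC : commutative tensor_add.
Proof. by move=> x y; apply: tensor_ext => W f fl; rewrite !tsum_add // addrC. Qed.
Fact tensor_add0 : left_id tensor_zero tensor_add.
Proof. by move=> x; apply: tensor_ext => W f fl; rewrite tsum_add // tsum0 // add0r. Qed.
Fact tensor_addN : left_inverse tensor_zero tensor_opp tensor_add.
Proof.
move=> x; apply: tensor_ext => W f fl.
by rewrite tsum_add // tsum_scale // tsum0 // scaleN1r addNr.
Qed.

HB.instance Definition _ :=
  GRing.isZmodule.Build tensor tensor_addA tensor_addC tensor_add0 tensor_addN.

Fact tensor_scaleA a b x :
  tensor_scale a (tensor_scale b x) = tensor_scale (a * b) x.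
Proof. by apply: tensor_ext => W f fl; rewrite !tsum_scale // scalerA. Qed.
Fact tensor_scale1 : left_id 1 tensor_scale.
Proof. by move=> x; apply: tensor_ext => W f fl; rewrite tsum_scale // scale1r. Qed.
Fact tensor_scaleDr : right_distributive tensor_scale +%R.
Proof.
move=> a x y; apply: tensor_ext => W f fl.
by rewrite tsum_scale // !tsum_add // !tsum_scale // scalerDr.
Qed.
Fact tensor_scaleDl x : {morph tensor_scale^~ x : a b / a + b}.
Proof.
move=> a b; apply: tensor_ext => W f fl.
by rewrite !tsum_add // !tsum_scale // scalerDl.
Qed.

HB.instance Definition _ := GRing.Zmodule_isLmodule.Build R tensor
  tensor_scaleA tensor_scale1 tensor_scaleDr tensor_scaleDl.

Lemma tens_bilinear : bilin tens.
Proof.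
by split=> [v a u u'|u a v v']; apply: tensor_ext => W f fl;
  rewrite tsum_add // tsum_scale // !tsum_tens // ?fl.1 ?fl.2.
Qed.

Lemma tsum_linear (W : lmodType R) (f : U -> V -> W) :
  bilin f -> linear (fun t : tensor => tsum t f).
Proof. by move=> fl a x y; rewrite tsum_add // tsum_scale. Qed.

Lemma tensor_span (x : tensor) : x = \sum_(p <- repr x) tens p.1 p.2.
Proof.
apply: tensor_ext => W f fl.
pose g : tensor -> W := fun t => tsum t f.
have g0 : g 0 = 0 by exact: tsum0.
have gD : {morph g : y z / y + z} by move=> y z; exact: tsum_add.
have -> : tsum (\sum_(p <- repr x) tens p.1 p.2) f =
          \sum_(p <- repr x) g (tens p.1 p.2) by apply: (big_morph g gD g0).
by rewrite {1}/tsum /formal_eval; apply: eq_bigr => p _; rewrite /g tsum_tens.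
Qed.

Lemma tsum_unique (W : lmodType R) (f : U -> V -> W) (g : tensor -> W) :
  linear g -> (forall u v, g (tens u v) = f u v) ->
  forall t, g t = tsum t f.
Proof.
move=> gl gf t; rewrite {1}[t]tensor_span /tsum /formal_eval.
have gD : {morph g : y z / y + z}.
  by move=> y z; have := gl 1 y z; rewrite !scale1r.
have g0 : g 0 = 0 by have := gD 0 0; rewrite addr0 -{1}[g 0]addr0 => /addrI <-.
by rewrite (big_morph g gD g0); apply: eq_bigr => p _; exact: gf.
Qed.

End Tensor.

Notation "U \ox V" := (tensor U V) (at level 40, left associativity) : type_scope.
Notation "u \ot v" := (tens u v) (at level 40, left associativity) : tensor_scope.
Notation "\tsum_ ( x , y <- t ) F" := (tsum t (fun x y => F))
  (at level 41, F at level 41, x binder, y binder, t at level 50,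
   format "'[' \tsum_ ( x ,  y  <-  t ) '/  '  F ']'") : tensor_scope.

(* Algebra and coalgebra operations are kept separate from the carrier because
   several algebra structures on one space are compared below. *)

Section Ordinary.
Variable k : fieldType.

Record alg_ops (A : lmodType k) := AlgOps {
  amul : A -> A -> A;
  aone : A }.

Definition alg_of (A : algType k) : alg_ops A :=
  AlgOps (fun x y : A => x * y) (1 : A).

Record coalg_ops (C : lmodType k) := CoalgOps {
  comul : C -> C \ox C;
  counit : C -> k }.

Record is_coalgebra (C : lmodType k) (D : coalg_ops C) : Prop := IsCoalgebra {
  comul_linear : linear (comul D);
  counit_scalar : scalar (counit D);
  coassociative : forall c,
    \tsum_(c1, c2 <- comul D c) \tsum_(x, y <- comul D c1) x \ot (y \ot c2) =
    \tsum_(c1, c2 <- comul D c) \tsum_(x, y <- comul D c2) c1 \ot (x \ot y);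
  counital_l : forall c, \tsum_(c1, c2 <- comul D c) counit D c1 *: c2 = c;
  counital_r : forall c, \tsum_(c1, c2 <- comul D c) counit D c2 *: c1 = c }.

Record is_bialgebra (A : algType k) (D : coalg_ops A) : Prop := IsBialgebra {
  bialgebra_coalgebra : is_coalgebra D;
  comul1 : comul D 1 = 1 \ot 1;
  comulM : forall x y, comul D (x * y) =
    \tsum_(x1, x2 <- comul D x) \tsum_(y1, y2 <- comul D y)
      (x1 * y1) \ot (x2 * y2);
  counit1 : counit D 1 = 1;
  counitM : forall x y, counit D (x * y) = counit D x * counit D y }.

(* [S] is a convolution inverse of the identity in Hom(A, A). *)
Definition is_antipode (A : algType k) (D : coalg_ops A) (S : A -> A) : Prop :=
  [/\ linear S,
      forall x, \tsum_(x1, x2 <- comul D x) S x1 * x2 = counit D x *: 1 &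
      forall x, \tsum_(x1, x2 <- comul D x) x1 * S x2 = counit D x *: 1].

Definition is_hopf_bij (A : algType k) (D : coalg_ops A) : Prop :=
  is_bialgebra D /\ exists S, is_antipode D S /\ bijective S.

Section LinearForms.
Variables (K : lmodType k) (A : alg_ops K) (D : coalg_ops K).
Implicit Types (g : K -> k) (s t : K \ox K -> k).

Definition conv1 g g' : K -> k :=
  fun x => \tsum_(x1, x2 <- comul D x) g x1 * g' x2.

Definition conv1_inverse g g' : Prop :=
  [/\ scalar g', conv1 g g' = counit D & conv1 g' g = counit D].

Definition conv1_invertible g : Prop := exists g', conv1_inverse g g'.

(* The convolution inverse is unique when it exists; junk value otherwise. *)
Definition conv1_inv g : K -> k :=
  xget (counit D) [set g' | conv1_inverse g g'].

Definition normalized1 g : Prop := g (aone A) = 1.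

Definition lazy1 g : Prop := forall x,
  \tsum_(x1, x2 <- comul D x) g x1 *: x2 =
  \tsum_(x1, x2 <- comul D x) g x2 *: x1.

Definition D1 g : K \ox K -> k := fun z =>
  \tsum_(x, y <- z)
  \tsum_(x1, x2 <- comul D x) \tsum_(y1, y2 <- comul D y)
    g x1 * g y1 * conv1_inv g (amul A x2 y2).

Definition normalized2 s : Prop := forall x,
  s (aone A \ot x) = counit D x /\ s (x \ot aone A) = counit D x.

Definition conv2 s t : K \ox K -> k := fun z =>
  \tsum_(x, y <- z)
  \tsum_(x1, x2 <- comul D x) \tsum_(y1, y2 <- comul D y)
    s (x1 \ot y1) * t (x2 \ot y2).

Definition counit2 : K \ox K -> k := fun z =>
  \tsum_(x, y <- z) counit D x * counit D y.

Definition conv2_inverse s s' : Prop :=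
  [/\ scalar s', conv2 s s' = counit2 & conv2 s' s = counit2].

Definition conv2_invertible s : Prop := exists s', conv2_inverse s s'.

Definition normalized_left_cocycle s : Prop :=
  [/\ scalar s, normalized2 s &
      forall x y z,
        \tsum_(x1, x2 <- comul D x) \tsum_(y1, y2 <- comul D y)
          s (x1 \ot y1) * s (amul A x2 y2 \ot z) =
        \tsum_(y1, y2 <- comul D y) \tsum_(z1, z2 <- comul D z)
          s (y1 \ot z1) * s (x \ot amul A y2 z2)].

Definition lazy2 s : Prop := forall x y,
  \tsum_(x1, x2 <- comul D x) \tsum_(y1, y2 <- comul D y)
    s (x1 \ot y1) *: amul A x2 y2 =
  \tsum_(x1, x2 <- comul D x) \tsum_(y1, y2 <- comul D y)
    s (x2 \ot y2) *: amul A x1 y1.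

(* The algebra with product h . h' = s(h_1, h'_1) h_2 h'_2. *)
Definition twist_alg s : alg_ops K :=
  AlgOps
    (fun x y => \tsum_(x1, x2 <- comul D x) \tsum_(y1, y2 <- comul D y)
                  s (x1 \ot y1) *: amul A x2 y2)
    (aone A).

Definition Z2L_set : set (K \ox K -> k) :=
  [set s | [/\ normalized_left_cocycle s, conv2_invertible s & lazy2 s]].

Definition B2L_set : set (K \ox K -> k) :=
  [set s | exists g, [/\ scalar g, normalized1 g, conv1_invertible g, lazy1 g
                       & s = D1 g]].

End LinearForms.
End Ordinary.

(* Possibly infinite groups carried by a subset of an ambient type. *)

Section Groups.

Record group_ops (T : Type) := GroupOps {
  carrier : set T;
  gmul : T -> T -> T;
  gone : T }.

Record is_group (T : Type) (G : group_ops T) : Prop := IsGroup {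
  gone_in : carrier G (gone G);
  gmul_in : forall x y, carrier G x -> carrier G y -> carrier G (gmul G x y);
  gmulA : forall x y z, carrier G x -> carrier G y -> carrier G z ->
    gmul G x (gmul G y z) = gmul G (gmul G x y) z;
  gmul1x : forall x, carrier G x -> gmul G (gone G) x = x;
  gmulx1 : forall x, carrier G x -> gmul G x (gone G) = x;
  ginv_ex : forall x, carrier G x -> exists2 y, carrier G y &
    gmul G x y = gone G /\ gmul G y x = gone G }.

Definition is_group_hom (T T' : Type) (G : group_ops T) (G' : group_ops T')
    (f : T -> T') : Prop :=
  [/\ is_group G, is_group G',
      forall x, carrier G x -> carrier G' (f x) &
      forall x y, carrier G x -> carrier G y ->
        f (gmul G x y) = gmul G' (f x) (f y)].

Definition coset (T : Type) (G : group_ops T) (N : set T) (x : T) : set T :=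
  [set gmul G x n | n in N].

Definition quotient_ops (T : Type) (G : group_ops T) (N : set T) :
    group_ops (set T) :=
  GroupOps [set coset G N x | x in carrier G]
           (fun X Y => [set gmul G x y | x in X & y in Y])
           (coset G N (gone G)).

End Groups.

Section LazyCohomology.
Variables (k : fieldType) (K : lmodType k) (A : alg_ops K) (D : coalg_ops K).

Definition Z2L : group_ops (K \ox K -> k) :=
  GroupOps (Z2L_set A D) (conv2 D) (counit2 D).

Definition H2L : group_ops (set (K \ox K -> k)) :=
  quotient_ops Z2L (B2L_set A D).

End LazyCohomology.

Section AdmissiblePair.
Variables (k : fieldType) (H B : algType k).

Record pair_ops := PairOps {
  coalgH : coalg_ops H;
  coalgB : coalg_ops B;
  act : H -> B -> B;
  coact : B -> H \ox B }.

Variable P : pair_ops.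

Local Notation DH := (comul (coalgH P)).
Local Notation eH := (counit (coalgH P)).
Local Notation DB := (comul (coalgB P)).
Local Notation eB := (counit (coalgB P)).
Local Notation "h |> b" := (act P h b) (at level 35, right associativity).
Local Notation rho := (coact P).

Record is_left_module : Prop := IsLeftModule {
  act_bilinear : bilin (act P);
  act1 : forall b, 1 |> b = b;
  actM : forall g h b, (g * h) |> b = g |> h |> b }.

Record is_left_comodule : Prop := IsLeftComodule {
  coact_linear : linear rho;
  coact_coassoc : forall b,
    \tsum_(x, b0 <- rho b) \tsum_(x1, x2 <- DH x) x1 \ot (x2 \ot b0) =
    \tsum_(x, b0 <- rho b) \tsum_(y, b00 <- rho b0) x \ot (y \ot b00);
  coact_counit : forall b, \tsum_(x, b0 <- rho b) eH x *: b0 = b }.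

Record is_admissible : Prop := IsAdmissible {
  adm_bialgebraH : is_bialgebra (coalgH P);
  adm_coalgebraB : is_coalgebra (coalgB P);
  adm_module : is_left_module;
  adm_comodule : is_left_comodule;
  adm_module_algebraM : forall h b c,
    h |> (b * c) = \tsum_(h1, h2 <- DH h) (h1 |> b) * (h2 |> c);
  adm_module_algebra1 : forall h, h |> 1 = eH h *: 1;
  adm_comodule_algebraM : forall b c,
    rho (b * c) = \tsum_(x, b0 <- rho b) \tsum_(y, c0 <- rho c)
                    (x * y) \ot (b0 * c0);
  adm_comodule_algebra1 : rho 1 = 1 \ot 1;
  adm_comodule_coalgebra : forall b,
    \tsum_(x, b0 <- rho b) \tsum_(b1, b2 <- DB b0) x \ot (b1 \ot b2) =
    \tsum_(b1, b2 <- DB b) \tsum_(x, b10 <- rho b1) \tsum_(y, b20 <- rho b2)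
      (x * y) \ot (b10 \ot b20);
  adm_comodule_counit : forall b, \tsum_(x, b0 <- rho b) eB b0 *: x = eB b *: 1;
  adm_module_coalgebra : forall h b,
    DB (h |> b) = \tsum_(h1, h2 <- DH h) \tsum_(b1, b2 <- DB b)
                    (h1 |> b1) \ot (h2 |> b2);
  adm_module_counit : forall h b, eB (h |> b) = eH h * eB b;
  adm_counit1 : eB 1 = 1;
  adm_counitM : forall b c, eB (b * c) = eB b * eB c;
  adm_comul1 : DB 1 = 1 \ot 1;
  adm_comulM : forall b c,
    DB (b * c) = \tsum_(b1, b2 <- DB b) \tsum_(c1, c2 <- DB c)
                 \tsum_(x, b20 <- rho b2)
                   (b1 * (x |> c1)) \ot (b20 * c2);
  adm_yetter_drinfeld : forall h b,
    \tsum_(h1, h2 <- DH h) \tsum_(x, b0 <- rho (h1 |> b)) (x * h2) \ot b0 =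
    \tsum_(h1, h2 <- DH h) \tsum_(x, b0 <- rho b) (h1 * x) \ot (h2 |> b0) }.

Definition is_hopf_admissible : Prop :=
  [/\ is_admissible, is_hopf_bij (coalgH P) &
      exists S, is_antipode (coalgB P) S].

(* The smash product A # H, for an algebra structure A on the H-module B. *)
Definition smash (A : alg_ops B) : alg_ops (B \ox H) :=
  AlgOps
    (fun z z' =>
       \tsum_(b, h <- z) \tsum_(b', h' <- z')
       \tsum_(h1, h2 <- DH h) amul A b (h1 |> b') \ot (h2 * h'))
    (aone A \ot 1).

(* The algebra and coalgebra structures of the Radford biproduct B x H. *)
Definition biprod_alg : alg_ops (B \ox H) := smash (alg_of B).

Definition biprod_coalg : coalg_ops (B \ox H) :=
  CoalgOps
    (fun z =>
       \tsum_(b, h <- z) \tsum_(b1, b2 <- DB b) \tsum_(h1, h2 <- DH h)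
       \tsum_(x, b20 <- rho b2) (b1 \ot (x * h1)) \ot (b20 \ot h2))
    (fun z => \tsum_(b, h <- z) eB b * eH h).

Implicit Types (g : B -> k) (s t : B \ox B -> k).

Definition yd_morphism1 g : Prop :=
  [/\ scalar g,
      forall h b, g (h |> b) = eH h * g b &
      forall b, \tsum_(x, b0 <- rho b) g b0 *: x = g b *: 1].

Definition yd_morphism2 s : Prop :=
  [/\ scalar s,
      forall h b c, \tsum_(h1, h2 <- DH h) s ((h1 |> b) \ot (h2 |> c)) =
                    eH h * s (b \ot c) &
      forall b c,
        \tsum_(x, b0 <- rho b) \tsum_(y, c0 <- rho c) s (b0 \ot c0) *: (x * y) =
        s (b \ot c) *: 1].

Definition yd_conv2 s t : B \ox B -> k := fun z =>
  \tsum_(b, c <- z)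
  \tsum_(b1, b2 <- DB b) \tsum_(c1, c2 <- DB c) \tsum_(x, b20 <- rho b2)
    s (b1 \ot (x |> c1)) * t (b20 \ot c2).

Definition yd_conv2_inverse s s' : Prop :=
  [/\ yd_morphism2 s', yd_conv2 s s' = counit2 (coalgB P)
    & yd_conv2 s' s = counit2 (coalgB P)].

Definition yd_conv2_invertible s : Prop := exists s', yd_conv2_inverse s s'.

Definition yd_conv1_invertible g : Prop :=
  exists2 g', yd_morphism1 g' & conv1_inverse (coalgB P) g g'.

Definition yd_normalized_left_cocycle s : Prop :=
  [/\ yd_morphism2 s, normalized2 (alg_of B) (coalgB P) s &
      forall a b c,
        \tsum_(a1, a2 <- DB a) \tsum_(b1, b2 <- DB b) \tsum_(x, a20 <- rho a2)
          s (a1 \ot (x |> b1)) * s ((a20 * b2) \ot c) =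
        \tsum_(b1, b2 <- DB b) \tsum_(c1, c2 <- DB c) \tsum_(x, b20 <- rho b2)
          s (b1 \ot (x |> c1)) * s (a \ot (b20 * c2))].

Definition yd_lazy2 s : Prop := forall b c,
  \tsum_(b1, b2 <- DB b) \tsum_(c1, c2 <- DB c) \tsum_(x, b20 <- rho b2)
    s (b1 \ot (x |> c1)) *: (b20 * c2) =
  \tsum_(b1, b2 <- DB b) \tsum_(c1, c2 <- DB c) \tsum_(x, b20 <- rho b2)
    s (b20 \ot c2) *: (b1 * (x |> c1)).

(* The algebra with product b . b' = s(b_1 (x) b_2^(-1) . b'_1) b_2^(0) b'_2. *)
Definition yd_twist_alg s : alg_ops B :=
  AlgOps
    (fun b c =>
       \tsum_(b1, b2 <- DB b) \tsum_(c1, c2 <- DB c) \tsum_(x, b20 <- rho b2)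
         s (b1 \ot (x |> c1)) *: (b20 * c2))
    1.

(* For a morphism [g] invertible in the Yetter-Drinfeld category, its inverse
   there is its convolution inverse, so [D1] and [lazy1] apply unchanged. *)
Definition yd_D1 g : B \ox B -> k := D1 (alg_of B) (coalgB P) g.

Definition yd_Z2L_set : set (B \ox B -> k) :=
  [set s | [/\ yd_normalized_left_cocycle s, yd_conv2_invertible s
             & yd_lazy2 s]].

Definition yd_B2L_set : set (B \ox B -> k) :=
  [set s | exists g,
     [/\ yd_morphism1 g, normalized1 (alg_of B) g, yd_conv1_invertible g,
         lazy1 (coalgB P) g & s = yd_D1 g]].

Definition yd_Z2L : group_ops (B \ox B -> k) :=
  GroupOps yd_Z2L_set yd_conv2 (counit2 (coalgB P)).

Definition yd_H2L : group_ops (set (B \ox B -> k)) :=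
  quotient_ops yd_Z2L yd_B2L_set.

Definition bar1 g : B \ox H -> k := fun z => \tsum_(b, h <- z) g b * eH h.

Definition bar2 s : (B \ox H) \ox (B \ox H) -> k := fun w =>
  \tsum_(z, z' <- w) \tsum_(b, h <- z) \tsum_(b', h' <- z')
    s (b \ot (h |> b')) * eH h'.

End AdmissiblePair.

(* Main.v *)
Require Import Defs.
From mathcomp Require Import all_boot all_order all_algebra.
From mathcomp Require Import boolp classical_sets.

(** Write [K] for the biproduct, [a # g] for its elements, and [bar2 s] for the
    extension of a 2-form [s] on [B].

    The assignment [bar2] is injective, since [bar2 s] at [b # 1] and [c # 1] is
    [s(b, c)], and it turns the braided convolution on [B] into the ordinary
    convolution on [K] ([bar2_conv]): the braiding is exactly what the
    comultiplication of [K] produces.  On morphisms it also reflects and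
    preserves the conditions that define lazy cocycles.  Indeed the cocycle
    identity on [K] at [a # g], [b # h], [c # l] is the one on [B] at [a],
    [g1 . b], [g2 . h . c] ([bar2_cocycleE]), and similarly for laziness
    ([bar2_lazyE]); here the Yetter-Drinfeld condition and the linearity and
    colinearity of [s] are used.  The comparison of the smash product with the
    twisted biproduct is [smash_twist], and the cocycle is unique because the
    counit of [K] recovers it from the twisted product ([twist_alg_inj]).

    The group structures are then obtained on [K] only.  For a bialgebra [K],
    2-forms are elements of the convolution algebra of forms on the coalgebra
    [K (x) K], and the cocycle identity is an equation between products of
    pullbacks in the convolution algebra of the threefold tensor power.
    Laziness says that a form commutes with whatever factors through the
    product of [K].  With these two remarks, that lazy cocycles form a group
    ([Z2L_group]) and that the lazy coboundaries form a central subgroup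
    ([B2L_central]) are short computations in associative algebras.  On [B] the
    same laws follow by injectivity of [bar2] ([yd_Z2L_group],
    [yd_B2L_central]), once convolution is known to preserve morphisms
    ([yd_conv2_morphism]).  A coboundary [D1] of [g] on [B] is sent to [D1] of
    the extension of [g] ([bar2_D1]), so that the homomorphism passes to the
    quotients.

    Computations with Sweedler sums are calculations with nested sums whose
    summand is multilinear.  The axioms are available as rules for such sums,
    and tactics find where a rule applies, discharge multilinearity, and
    compare two nests up to the order of summation. *)

Set Implicit Arguments.
Unset Strict Implicit.
Unset Printing Implicit Defensive.

Import GRing.Theory.
Local Open Scope ring_scope.

(** * Linearity of Sweedler sums *)

(** Transparent to conversion but a head symbol of its own, so that tactics can
    recognise linearity goals; scalar functions are covered with [k^o]. *)
Definition lin (k : nzRingType) (U V : lmodType k) (f : U -> V) : Prop := linear f.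

Section Sums.
Variables (R : comNzRingType) (U V : lmodType R) (W : nmodType).

Lemma eq_tsum (t : U \ox V) (F G : U -> V -> W) :
  (forall a b, F a b = G a b) -> tsum t F = tsum t G.
Proof. by move=> FG; apply: eq_bigr => p _; rewrite FG. Qed.
End Sums.

Lemma tsum_exchange (R : comNzRingType) (U V X Y : lmodType R) (W : nmodType)
    (s : X \ox Y) (t : U \ox V) (E : X -> Y -> W) (G : X -> Y -> U -> V -> W) :
  (forall a b, E a b = tsum t (G a b)) ->
  tsum s E = tsum t (fun u v => tsum s (fun a b => G a b u v)).
Proof.
move=> EG; rewrite (eq_tsum _ EG) /tsum /formal_eval.
exact: exchange_big.
Qed.

(** Goals of the tactics below have the form [L = R] with [L] a nest of sums and
    [R] usually an existential variable, to be instantiated by the rewritten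
    nest.  This one passes below the outermost sum of [L]. *)
Ltac under_tsum :=
  match goal with |- @tsum ?R ?U ?V ?W ?t _ = _ =>
    eapply (@eq_tsum R U V W t); intros; cbv beta end.

Notation slin f := (@lin _ _ (GRing.regular _) f).

Section Lin.
Variable k : fieldType.
Implicit Types U V W : lmodType k.

Lemma linD U V (f : U -> V) : lin f -> {morph f : x y / x + y}.
Proof. by move=> fl x y; have := fl 1 x y; rewrite !scale1r. Qed.

Lemma lin0 U V (f : U -> V) : lin f -> f 0 = 0.
Proof. by move=> fl; have := linD fl 0 0; rewrite addr0 -{1}[f 0]addr0 => /addrI. Qed.

Lemma linZ U V (f : U -> V) : lin f -> forall a x, f (a *: x) = a *: f x.
Proof. by move=> fl a x; have := fl a x 0; rewrite (lin0 fl) !addr0. Qed.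

Lemma lin_id U : lin (fun x : U => x). Proof. by []. Qed.

Lemma lin_comp U V W (f : V -> W) (g : U -> V) :
  lin f -> lin g -> lin (fun x => f (g x)).
Proof. by move=> fl gl a x y; rewrite gl fl. Qed.

Lemma lin_tsum_body U V W (X : lmodType k) (t : U \ox V) (F : X -> U -> V -> W) :
  (forall a b, lin (fun x => F x a b)) -> lin (fun x => tsum t (F x)).
Proof.
move=> Fl a x y; rewrite /tsum /formal_eval scaler_sumr -big_split /=.
by apply: eq_bigr => p _; rewrite Fl.
Qed.

Lemma lin_tsum U V W (F : U -> V -> W) :
  (forall b, lin (fun a => F a b)) -> (forall a, lin (fun b => F a b)) ->
  lin (fun t : U \ox V => tsum t F).
Proof. by move=> Fl Fr; apply: tsum_linear; split. Qed.

Lemma lin_tensl U V (v : V) : lin (fun u : U => u \ot v).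
Proof. exact: (tens_bilinear U V).1. Qed.
Lemma lin_tensr U V (u : U) : lin (fun v : V => u \ot v).
Proof. exact: (tens_bilinear U V).2. Qed.
Lemma tensZl U V a (u : U) (v : V) : (a *: u) \ot v = a *: (u \ot v).
Proof. exact: (linZ (lin_tensl v)). Qed.
Lemma tensZr U V a (u : U) (v : V) : u \ot (a *: v) = a *: (u \ot v).
Proof. exact: (linZ (lin_tensr u)). Qed.
Lemma lin_scalel U (v : U) : @lin k k^o U (fun a : k => a *: v).
Proof. by move=> a x y; rewrite scalerDl scalerA. Qed.
Lemma lin_scaler U (a : k) : lin (fun v : U => a *: v).
Proof. by move=> b x y; rewrite scalerDr !scalerA mulrC. Qed.
Lemma lin_mull (A : algType k) (v : A) : lin (fun u : A => u * v).
Proof. by move=> b x y; rewrite mulrDl scalerAl. Qed.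
Lemma lin_mulr (A : algType k) (v : A) : lin (fun u : A => v * u).
Proof. by move=> b x y; rewrite mulrDr scalerAr. Qed.
Lemma lin_kmull (v : k) : @lin k k^o k^o (fun u : k => u * v).
Proof. exact: (lin_mull (A := k^o)). Qed.
Lemma lin_kmulr (v : k) : @lin k k^o k^o (fun u : k => v * u).
Proof. exact: (lin_mulr (A := k^o)). Qed.

(** No condition on [F]: a Sweedler sum is a finite sum over a representative. *)
Lemma lin_sum U V W W' (f : W -> W') (t : U \ox V) (F : U -> V -> W) :
  lin f -> f (tsum t F) = tsum t (fun a b => f (F a b)).
Proof.
move=> fl; rewrite /tsum /formal_eval.
by rewrite (big_morph f (linD fl) (lin0 fl)).
Qed.

Section Tsum.
Variables U V X Y : lmodType k.

(** Here and below, bilinearity is what makes the sum independent of the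
    representative that [tsum] chooses. *)
Lemma tsum_pure W u v (F : U -> V -> W) :
  (forall b, lin (fun a => F a b)) -> (forall a, lin (fun b => F a b)) ->
  tsum (u \ot v) F = F u v.
Proof. by move=> Fl Fr; rewrite tsum_tens. Qed.

Lemma tsum_tsum W (t : X \ox Y) (T : X -> Y -> U \ox V) (F : U -> V -> W) :
  (forall b, lin (fun a => F a b)) -> (forall a, lin (fun b => F a b)) ->
  tsum (tsum t T) F = tsum t (fun x y => tsum (T x y) F).
Proof.
by move=> Fl Fr; rewrite (@lin_sum _ _ _ _ (fun t => tsum t F)) //; exact: lin_tsum.
Qed.

Lemma tensor_hom_eq W (f g : U \ox V -> W) : lin f -> lin g ->
  (forall u v, f (u \ot v) = g (u \ot v)) -> f = g.
Proof.
move=> fl gl fg; apply/funext => t.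
by rewrite (tsum_unique fl (f := fun u v => g (u \ot v))) // -(tsum_unique gl).
Qed.
End Tsum.
End Lin.

(** * Tactics for Sweedler sums *)

Create HintDb lin.

Ltac lin_basic :=
  solve [ assumption | apply: lin_id | apply: lin_tensl | apply: lin_tensr
        | apply: lin_scalel | apply: lin_scaler | apply: lin_kmull
        | apply: lin_kmulr | apply: lin_mull | apply: lin_mulr
        | eauto with lin].

(** Follows the argument of [f] down to its occurrence in the body.  In a
    multilinear expression the argument occurs exactly once, so each step is
    forced: it sits either in the tensor that is summed over or in the summand.
    An attempt on the wrong branch fails, as the argument would escape. *)
Ltac solve_lin := intros; cbv beta;
  lazymatch goal with
  | |- lin (fun x => x) => apply lin_id
  | |- lin (fun x : ?T => tsum _ _) =>
    first
      [ match goal with |- @lin ?k ?U ?W (fun x => @tsum _ ?A ?B _ ?t (@?F x)) =>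
          apply: (@lin_tsum_body _ A B W U t F) end
      | match goal with |- @lin ?k ?U ?W (fun x => @tsum _ ?A ?B _ (@?t x) ?F) =>
          apply: (@lin_comp _ U (tensor A B) W (fun z => tsum z F) t);
              [apply: lin_tsum|] end ]; solve_lin
  | |- lin (fun x : ?T => _) =>
    first
      [ lin_basic
      | match goal with |- @lin ?k ?U ?W (fun x => ?f (@?g x)) =>
          first [apply: (@lin_comp _ U k^o W f g) | apply: (@lin_comp _ U _ W f g)];
           [lin_basic | solve_lin] end
      | match goal with |- @lin ?k ?U ?W (fun x => ?f (@?g x) ?y) =>
          first [ apply: (@lin_comp _ U k^o W (fun z => f z y) g)
                | apply: (@lin_comp _ U _ W (fun z => f z y) g) ];
           [lin_basic | solve_lin] end ]
  | |- lin _ => lin_basic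
  end.

Ltac pull t :=
  lazymatch goal with
  | |- tsum ?s ?E = _ =>
    first [constr_eq s t; reflexivity | match goal with |- @tsum ?R ?X ?Y ?W ?s _ = _ =>
      match type of t with @tensor _ ?U ?V =>
      eapply (@tsum_exchange R U V X Y W s t); intros ? ?; cbv beta; pull t end end]
  end.

Ltac front t := etransitivity; [pull t | cbv beta].

(** Equality of two nests up to the order of summation: each variable being used
    once, the tensor under a sum on one side identifies its partner on the
    other side. *)
Ltac reorder :=
  lazymatch goal with
  | |- tsum ?t _ = _ =>
    etransitivity; [|symmetry; pull t]; under_tsum; reorder
  | _ => try reflexivity
  end.

(** [anywhere] applies a rule at the outermost place of a nest where it fits;
    [within t] does so below the sum over [t]; [in_body] acts on the summand. *)
Ltac anywhere tac := first [tac | under_tsum; anywhere tac].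
Tactic Notation "step" tactic3(tac) := etransitivity; [anywhere tac|]; cbv beta.
Ltac within t tac :=
  etransitivity; [etransitivity; [pull t | under_tsum; anywhere tac] |]; cbv beta.
Ltac to_body tac :=
  lazymatch goal with
  | |- tsum _ _ = _ => under_tsum; to_body tac
  | _ => tac
  end.
Tactic Notation "in_body" tactic3(tac) :=
  etransitivity; [to_body ltac:(tac; reflexivity)|]; cbv beta.
Tactic Notation "rewrite_in" uconstr(L) :=
  etransitivity; [anywhere ltac:(rewrite L; reflexivity)|]; cbv beta.

Lemma tsum_swap (R : comNzRingType) (U V X Y : lmodType R) (W : nmodType)
    (s : X \ox Y) (t : U \ox V) (F : X -> Y -> U -> V -> W) :
  tsum s (fun a b => tsum t (F a b)) = tsum t (fun u v => tsum s (fun a b => F a b u v)).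
Proof. exact: tsum_exchange. Qed.

(** Moves the outermost sum inwards, past the sums that do not depend on it. *)
Ltac sink :=
  first
  [ etransitivity;
    [ match goal with
      |- @tsum ?R ?X ?Y ?W ?s (fun a b => @tsum _ ?U ?V _ ?t (@?F a b)) = _ =>
        exact (@tsum_swap R U V X Y W s t F) end
    | cbv beta; under_tsum; sink ]
  | reflexivity ].

(** Normal form: all sums in front, none over a pure tensor or over a sum. *)
Ltac flatten :=
  lazymatch goal with
  | |- tsum (tsum ?t ?T) ?F = _ =>
    etransitivity;
    [ (first [apply: tsum_tsum | apply: (@tsum_tsum _ _ _ _ _ _^o)]); solve_lin
    | cbv beta; flatten ]
  | |- tsum (?u \ot ?v) ?F = _ =>
    etransitivity;
    [ (first [apply: tsum_pure | apply: (@tsum_pure _ _ _ _^o)]); solve_lin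
    | cbv beta; flatten ]
  | |- tsum ?t ?F = _ => under_tsum; flatten
  | |- ?L = _ =>
    first
    [ match L with context [@tsum ?k ?U ?V ?W ?t ?F] =>
      let L' := eval pattern (@tsum k U V W t F) in L in
      match L' with ?f _ =>
        etransitivity;
        [ first [ apply: (@lin_sum _ U V _ _ f) | apply: (@lin_sum _ U V _^o _ f)
                | apply: (@lin_sum _ U V _ _^o f) | apply: (@lin_sum _ U V _^o _^o f) ]; solve_lin
        | cbv beta; flatten ] end end
    | reflexivity ]
  end.

Tactic Notation "expand" := etransitivity; [flatten|].

Lemma tensor_eq (k : fieldType) (U V W : lmodType k) (f g : U \ox V -> W) :
  lin f -> lin g -> (forall u v, f (u \ot v) = g (u \ot v)) -> forall z, f z = g z.
Proof. by move=> fl gl fg z; rewrite (tensor_hom_eq fl gl fg). Qed.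

(** The scalar case is apart because [k] is a module over itself only as [k^o]. *)
Lemma tensor_eqk (k : fieldType) (U V : lmodType k) (f g : U \ox V -> k) :
  slin f -> slin g -> (forall u v, f (u \ot v) = g (u \ot v)) ->
  forall z, f z = g z.
Proof. exact: tensor_eq. Qed.

Lemma tsum_tensE (k : fieldType) (U V : lmodType k) (t : U \ox V) :
  \tsum_(x, y <- t) x \ot y = t.
Proof.
by apply: (tensor_eq (f := fun t => tsum t _)) t => [||u v];
  [solve_lin|solve_lin|flatten].
Qed.

(** * Coassociativity and counit under a sum *)

Section Coalg.
Variables (k : fieldType) (C : lmodType k) (D : coalg_ops C).
Hypothesis Dc : is_coalgebra D.

Lemma comul_lin : lin (comul D). Proof. exact: comul_linear Dc. Qed.
Lemma counit_lin : lin (V := k^o) (counit D). Proof. exact: counit_scalar Dc. Qed.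

Variable W : lmodType k.

(** The premise on [E] leaves room for other sums between the two sums over
    comultiplications: [E] is the summand as found, and only has to be equal to
    one where the second sum comes first. *)
Lemma coassoc_sum c (F : C -> C -> C -> W) E :
  (forall c1 c2, E c1 c2 = tsum (comul D c1) (fun x y => F x y c2)) ->
  (forall b c, lin (fun a => F a b c)) ->
  (forall a c, lin (fun b => F a b c)) ->
  (forall a b, lin (fun c => F a b c)) ->
  tsum (comul D c) E =
  \tsum_(c1, c2 <- comul D c) \tsum_(x, y <- comul D c2) F c1 x y.
Proof.
move=> EF F1 F2 F3; rewrite (eq_tsum _ EF).
have := congr1 (fun t : C \ox (C \ox C) => tsum t (fun a s => tsum s (fun b c => F a b c)))
   (coassociative Dc c).
move=> H; etransitivity; [|etransitivity; [exact: H|]]; [symmetry|]; flatten.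
Qed.

Lemma coassoc_sum_rev c (F : C -> C -> C -> W) E :
  (forall c1 c2, E c1 c2 = tsum (comul D c2) (fun x y => F c1 x y)) ->
  (forall b c, lin (fun a => F a b c)) ->
  (forall a c, lin (fun b => F a b c)) ->
  (forall a b, lin (fun c => F a b c)) ->
  tsum (comul D c) E =
  \tsum_(c1, c2 <- comul D c) \tsum_(x, y <- comul D c1) F x y c2.
Proof.
move=> EF F1 F2 F3; rewrite (eq_tsum _ EF); symmetry.
exact: coassoc_sum.
Qed.

Lemma counit_suml c (F : k -> C -> W) E :
  (forall c1 c2, E c1 c2 = F (counit D c1) c2) ->
  (forall c, lin (U := k^o) (fun a => F a c)) -> (forall a, lin (fun c => F a c)) ->
  tsum (comul D c) E = F 1 c.
Proof.
move=> EF F1 F2; rewrite (eq_tsum _ EF).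
rewrite -{2}(counital_l Dc c) (lin_sum _ _ (F2 1)); apply: eq_tsum => x y.
by rewrite (linZ (F2 1)) -(linZ (F1 y)) [_ *: _]mulr1.
Qed.

Lemma counit_sumr c (F : C -> k -> W) E :
  (forall c1 c2, E c1 c2 = F c1 (counit D c2)) ->
  (forall a, lin (U := k^o) (fun c => F a c)) -> (forall c, lin (fun a => F a c)) ->
  tsum (comul D c) E = F c 1.
Proof.
move=> EF F1 F2; rewrite (eq_tsum _ EF).
rewrite -{2}(counital_r Dc c) (lin_sum _ _ (F2 1)); apply: eq_tsum => x y.
by rewrite (linZ (F2 1)) -(linZ (F1 x)) [_ *: _]mulr1.
Qed.
End Coalg.
#[export] Hint Resolve comul_lin counit_lin : lin.

(** Premise of a sum rule on a nested sum: the inner sum is brought next to the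
    outer one. *)
Ltac by_front :=
  intros ? ?; match goal with |- _ = tsum ?t _ => front t; reflexivity end.

(** Premises of the sum rules that contract one tensor factor to a scalar: the
    scalar, wherever it occurs in the body, becomes an argument of the unknown
    multilinear function. *)
Ltac by_pattern_left :=
  let c1 := fresh in let c2 := fresh in intros c1 c2;
  match goal with |- ?L = ?F ?e c2 =>
    let L' := eval pattern e, c2 in L in
    match L' with ?f _ _ => unify F f; reflexivity end end.
Ltac by_pattern_right :=
  let c1 := fresh in let c2 := fresh in intros c1 c2;
  match goal with |- ?L = ?F c1 ?e =>
    let L' := eval pattern c1, e in L in
    match L' with ?f _ _ => unify F f; reflexivity end end.

Ltac use_coassoc Dc :=
  first [eapply (coassoc_sum Dc) | eapply (coassoc_sum Dc (W := _^o))];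
  [by_front | solve_lin..].
Tactic Notation "coassoc" constr(Dc) := step (use_coassoc Dc).

Ltac use_coassoc_rev Dc :=
  first [eapply (coassoc_sum_rev Dc) | eapply (coassoc_sum_rev Dc (W := _^o))];
  [by_front | solve_lin..].

Ltac use_counitl Dc :=
  etransitivity;
  [first [eapply (counit_suml Dc) | eapply (counit_suml Dc (W := _^o))];
  [by_pattern_left | solve_lin..]
  | cbv beta; reflexivity].
Ltac use_counitr Dc :=
  etransitivity;
  [first [eapply (counit_sumr Dc) | eapply (counit_sumr Dc (W := _^o))];
  [by_pattern_right | solve_lin..]
  | cbv beta; reflexivity].
Tactic Notation "counit" constr(Dc) := step (first [use_counitl Dc|use_counitr Dc]).

(** * Convolution and its actions *)

Section Conv.
Variables (k : fieldType) (C : lmodType k) (D : coalg_ops C).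
Hypothesis Dc : is_coalgebra D.

Section Actions.
Variable V : lmodType k.

Definition convl (s : C -> k) (f : C -> V) : C -> V :=
  fun c => \tsum_(c1, c2 <- comul D c) s c1 *: f c2.
Definition convr (f : C -> V) (s : C -> k) : C -> V :=
  fun c => \tsum_(c1, c2 <- comul D c) s c2 *: f c1.
Implicit Types (s t : C -> k) (f : C -> V).

(** With [convrA] and [convlr]: linear maps from [C] to [V] form a bimodule over
    the convolution algebra of linear forms on [C]. *)
Lemma convlA s t f : slin s -> slin t -> lin f ->
  convl (conv1 D s t) f = convl s (convl t f).
Proof.
move=> sl tl fl; apply/funext => c; rewrite /convl /conv1.
expand. coassoc Dc. symmetry; expand; reorder. by rewrite scalerA.
Qed.

Lemma convrA s t f : slin s -> slin t -> lin f ->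
  convr f (conv1 D s t) = convr (convr f s) t.
Proof.
move=> sl tl fl; apply/funext => c; rewrite /convr /conv1.
symmetry; expand; coassoc Dc; symmetry; expand; reorder.
by rewrite scalerA mulrC.
Qed.

Lemma convlr s t f : slin s -> slin t -> lin f ->
  convl s (convr f t) = convr (convl s f) t.
Proof.
move=> sl tl fl; apply/funext => c; rewrite /convl /convr.
symmetry; expand; coassoc Dc; symmetry; expand; reorder.
by rewrite !scalerA mulrC.
Qed.

Lemma convl1 f : lin f -> convl (counit D) f = f.
Proof.
move=> fl; apply/funext => c; rewrite /convl.
counit Dc. by rewrite scale1r.
Qed.

Lemma convr1 f : lin f -> convr f (counit D) = f.
Proof.
move=> fl; apply/funext => c; rewrite /convr.
counit Dc. by rewrite scale1r.
Qed.

Lemma convl_lin s f : slin s -> lin f -> lin (convl s f).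
Proof. by move=> sl fl; rewrite /convl; solve_lin. Qed.
Lemma convr_lin s f : slin s -> lin f -> lin (convr f s).
Proof. by move=> sl fl; rewrite /convr; solve_lin. Qed.

(** Laziness in general form.  For [f] the identity it is laziness of a form on
    [C]; for [f] the product of a bialgebra it is laziness of a 2-form. *)
Definition commutes s f := convl s f = convr f s.

Lemma commutesM s t f : slin s -> slin t -> lin f ->
  commutes s f -> commutes t f -> commutes (conv1 D s t) f.
Proof.
rewrite /commutes => sl tl fl sf tf.
by rewrite convlA // tf convlr // sf convrA.
Qed.
End Actions.

Section Monoid.
Implicit Types s t u : C -> k.

Lemma conv1_lin s t : slin s -> slin t -> slin (conv1 D s t).
Proof. by move=> sl tl; rewrite /conv1; solve_lin. Qed.

Lemma conv1E s t : conv1 D s t = convl (V := k^o) s t.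
Proof. by []. Qed.

Lemma convrE s t : convr (V := k^o) s t = conv1 D s t.
Proof. by apply/funext => c; apply: eq_tsum => x y; rewrite [_ *: _]mulrC. Qed.

Lemma conv1A s t u : slin s -> slin t -> slin u ->
  conv1 D s (conv1 D t u) = conv1 D (conv1 D s t) u.
Proof. by move=> sl tl ul; rewrite !conv1E -convlA. Qed.

Lemma conv1e s : slin s -> conv1 D (counit D) s = s.
Proof. by move=> sl; rewrite conv1E convl1. Qed.

Lemma conve1 s : slin s -> conv1 D s (counit D) = s.
Proof. by move=> sl; rewrite -convrE convr1. Qed.

Lemma conv1_inverse_unique s t u : slin s ->
  conv1_inverse D s t -> conv1_inverse D s u -> t = u.
Proof.
move=> sl [tl st ts] [ul su us].
by rewrite -[t]conve1 // -su conv1A // ts conv1e.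
Qed.

Lemma conv1_invE s t : slin s -> conv1_inverse D s t -> conv1_inv D s = t.
Proof.
move=> sl st; apply: (conv1_inverse_unique sl) => //.
exact: (xgetPex (counit D) (ex_intro (conv1_inverse D s) t st)).
Qed.

Lemma conv1_inverse_sym s t : slin s -> conv1_inverse D s t -> conv1_inverse D t s.
Proof. by move=> sl [tl st ts]. Qed.

Lemma conv1_inverse_mul s s' t t' : slin s -> slin t ->
  conv1_inverse D s s' -> conv1_inverse D t t' ->
  conv1_inverse D (conv1 D s t) (conv1 D t' s').
Proof.
move=> sl tl [sl' ss' s's] [tl' tt' t't].
have L := conv1_lin.
split; first exact: conv1_lin.
  by rewrite conv1A -?[conv1 D (conv1 D s t) t']conv1A ?tt' ?conve1 //; apply: L.
by rewrite conv1A -?[conv1 D (conv1 D t' s') s]conv1A ?s's ?conve1 //; apply: L.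
Qed.

Lemma conv1_inverse1 : conv1_inverse D (counit D) (counit D).
Proof. by have el := counit_lin Dc; split=> //; rewrite conv1e. Qed.
End Monoid.

Section Commutes.
Variables V W : lmodType k.
Implicit Types (s t : C -> k) (f : C -> V).

(** Multiply the equality of the two actions of [s] by [t] on both sides. *)
Lemma commutesV s t f : slin s -> lin f -> conv1_inverse D s t ->
  commutes s f -> commutes t f.
Proof.
rewrite /commutes => sl fl [tl st ts] sf.
rewrite -[f in LHS]convr1 // -st convrA // -sf convlr //; last exact: convl_lin.
by rewrite -convlA // ts convl1.
Qed.

Lemma commutes1 f : lin f -> commutes (counit D) f.
Proof. by move=> fl; rewrite /commutes convl1 ?convr1. Qed.

(** Taking [g] to be a linear form turns laziness with respect to [f] into
    commutation, in the convolution algebra, with all forms factoring through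
    [f]. *)
Lemma commutes_comp s f (g : V -> W) : lin g -> commutes s f -> commutes s (g \o f).
Proof.
move=> gl sf; apply/funext => c; have := congr1 (fun h => g (h c)) sf.
rewrite /convl /convr !(lin_sum _ _ gl) => sfc.
by etransitivity; [|etransitivity; [exact: sfc|]]; apply: eq_tsum => x y;
  rewrite (linZ gl).
Qed.
End Commutes.

Lemma commutes_conv1 (s t : C -> k) : commutes (V := k^o) s t ->
  conv1 D s t = conv1 D t s.
Proof. by rewrite /commutes convrE. Qed.

End Conv.

(** * Coalgebra maps and tensor products of coalgebras *)

Section CoalgebraMaps.
Variable k : fieldType.

Record is_cmap (C C' : lmodType k) (D : coalg_ops C) (D' : coalg_ops C')
    (f : C -> C') : Prop := IsCmap {
  cmap_lin : lin f;
  cmap_comul : forall c,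
    comul D' (f c) = \tsum_(x, y <- comul D c) f x \ot f y;
  cmap_counit : forall c, counit D' (f c) = counit D c }.

Lemma cmap_comp (C C' C'' : lmodType k) (D : coalg_ops C) (D' : coalg_ops C')
    (D'' : coalg_ops C'') (f : C -> C') (g : C' -> C'') :
  is_cmap D D' f -> is_cmap D' D'' g -> is_cmap D D'' (g \o f).
Proof.
move=> [fl fM fe] [gl gM ge]; split=> [|c|c] /=; last by rewrite ge fe.
  exact: lin_comp.
by rewrite gM fM; flatten.
Qed.

(** Pulling back along a coalgebra map is a morphism of convolution algebras. *)
Lemma conv1_cmap (C C' : lmodType k) (D : coalg_ops C) (D' : coalg_ops C')
    (f : C -> C') (s t : C' -> k) : is_cmap D D' f -> slin s -> slin t ->
  conv1 D (s \o f) (t \o f) = conv1 D' s t \o f.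
Proof.
move=> [fl fM fe] sl tl; apply/funext => c; rewrite /conv1 /= fM.
by symmetry; flatten.
Qed.

Lemma counit_cmap (C C' : lmodType k) (D : coalg_ops C) (D' : coalg_ops C')
    (f : C -> C') : is_cmap D D' f -> counit D' \o f = counit D.
Proof. by move=> [fl fM fe]; apply/funext => c /=; rewrite fe. Qed.

Lemma slin_comp (U V : lmodType k) (s : V -> k) (f : U -> V) :
  slin s -> lin f -> slin (s \o f).
Proof. exact: lin_comp. Qed.

Lemma conv1_inverse_cmap (C C' : lmodType k) (D : coalg_ops C)
    (D' : coalg_ops C') (f : C -> C') (s t : C' -> k) :
  is_cmap D D' f -> slin s ->
  conv1_inverse D' s t -> conv1_inverse D (s \o f) (t \o f).
Proof.
move=> fm sl [tl st ts]; split; first exact: slin_comp tl (cmap_lin fm).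
  by rewrite (conv1_cmap fm) // st (counit_cmap fm).
by rewrite (conv1_cmap fm) // ts (counit_cmap fm).
Qed.

Lemma commutes_cmap (C C' : lmodType k) (D : coalg_ops C) (D' : coalg_ops C')
    (V : lmodType k) (f : C -> C') (s : C' -> k) (g : C' -> V) :
  is_cmap D D' f -> slin s -> lin g ->
  commutes D' s g -> commutes D (s \o f) (g \o f).
Proof.
move=> [fl fM fe] sl gl sg; apply/funext => c.
have := congr1 (fun h => h (f c)) sg; rewrite /convl /convr fM => sgc.
by etransitivity; [|etransitivity; [exact: sgc|]]; [symmetry|]; flatten.
Qed.
End CoalgebraMaps.

Section TensorCoalgebra.
Variables (k : fieldType) (C C' : lmodType k).
Variables (D : coalg_ops C) (D' : coalg_ops C').

Definition tensor_coalg : coalg_ops (C \ox C') :=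
  CoalgOps
    (fun z => \tsum_(x, y <- z) \tsum_(x1, x2 <- comul D x)
              \tsum_(y1, y2 <- comul D' y) (x1 \ot y1) \ot (x2 \ot y2))
    (fun z => \tsum_(x, y <- z) counit D x * counit D' y).

Hypotheses (Dc : is_coalgebra D) (Dc' : is_coalgebra D').

Lemma tensor_comul x y : comul tensor_coalg (x \ot y) =
  \tsum_(x1, x2 <- comul D x) \tsum_(y1, y2 <- comul D' y)
     (x1 \ot y1) \ot (x2 \ot y2).
Proof. rewrite /=; flatten. Qed.

Lemma tensor_counit x y :
  counit tensor_coalg (x \ot y) = counit D x * counit D' y.
Proof. rewrite /=; flatten. Qed.

Lemma tensor_comul_lin : lin (comul tensor_coalg).
Proof. rewrite /=; solve_lin. Qed.
Lemma tensor_counit_lin : slin (counit tensor_coalg).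
Proof. rewrite /=; solve_lin. Qed.
Local Hint Resolve tensor_comul_lin tensor_counit_lin : lin.

Lemma tensor_coalgebra : is_coalgebra tensor_coalg.
Proof.
split; [exact: tensor_comul_lin | exact: tensor_counit_lin | | |].
- apply: tensor_eq; [by solve_lin | by solve_lin |] => u v; rewrite tensor_comul.
  expand. rewrite_in tensor_comul. expand. symmetry.
  expand. rewrite_in tensor_comul. expand. symmetry.
  coassoc Dc. coassoc Dc'. reorder.
- apply: tensor_eq; [by solve_lin | by solve_lin |] => u v; rewrite tensor_comul.
  expand. rewrite_in tensor_counit. counit Dc. counit Dc'.
  by rewrite mulr1 scale1r.
- apply: tensor_eq; [by solve_lin | by solve_lin |] => u v; rewrite tensor_comul.
  expand. rewrite_in tensor_counit. counit Dc. counit Dc'.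
  by rewrite mulr1 scale1r.
Qed.

Definition tproj1 (z : C \ox C') : C := \tsum_(x, y <- z) counit D' y *: x.
Definition tproj2 (z : C \ox C') : C' := \tsum_(x, y <- z) counit D x *: y.

Lemma tproj1E x y : tproj1 (x \ot y) = counit D' y *: x.
Proof. rewrite /tproj1; flatten. Qed.
Lemma tproj2E x y : tproj2 (x \ot y) = counit D x *: y.
Proof. rewrite /tproj2; flatten. Qed.
Lemma tproj1_lin : lin tproj1. Proof. rewrite /tproj1; solve_lin. Qed.
Lemma tproj2_lin : lin tproj2. Proof. rewrite /tproj2; solve_lin. Qed.
Local Hint Resolve tproj1_lin tproj2_lin : lin.

Lemma tproj1_cmap : is_cmap tensor_coalg D tproj1.
Proof.
split; first exact: tproj1_lin.
  apply: tensor_eq; [by solve_lin | by solve_lin |] => u v.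
  rewrite tproj1E tensor_comul (linZ (comul_lin Dc)) -[comul D u]tsum_tensE.
  symmetry; expand. in_body (rewrite !tproj1E). counit Dc'.
  symmetry; expand; reorder.
  by rewrite scale1r tensZr.
apply: tensor_eqk; [by solve_lin | by solve_lin |] => u v.
by rewrite tproj1E tensor_counit (linZ (counit_lin Dc)) mulrC.
Qed.

Lemma tproj2_cmap : is_cmap tensor_coalg D' tproj2.
Proof.
split; first exact: tproj2_lin.
  apply: tensor_eq; [by solve_lin | by solve_lin |] => u v.
  rewrite tproj2E tensor_comul (linZ (comul_lin Dc')) -[comul D' v]tsum_tensE.
  symmetry; expand. in_body (rewrite !tproj2E). counit Dc.
  symmetry; expand; reorder.
  by rewrite scale1r tensZr.
apply: tensor_eqk; [by solve_lin | by solve_lin |] => u v.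
by rewrite tproj2E tensor_counit (linZ (counit_lin Dc')).
Qed.

(** Inserting a grouplike element; for the unit of a bialgebra, normalization of
    a 2-form says that its pullbacks along the two insertions are the counit. *)
Lemma tpair1_cmap v : comul D' v = v \ot v -> counit D' v = 1 ->
  is_cmap D tensor_coalg (fun x => x \ot v).
Proof.
move=> vM ve; split=> [|x|x]; first by solve_lin.
  by rewrite tensor_comul vM; flatten.
by rewrite tensor_counit ve mulr1.
Qed.

Lemma tpair2_cmap u : comul D u = u \ot u -> counit D u = 1 ->
  is_cmap D' tensor_coalg (fun y => u \ot y).
Proof.
move=> uM ue; split=> [|x|x]; first by solve_lin.
  by rewrite tensor_comul uM; flatten.
by rewrite tensor_counit ue mul1r.
Qed.
End TensorCoalgebra.

Section TensorMap.
Variables (k : fieldType) (C C' E E' : lmodType k).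
Variables (D : coalg_ops C) (D' : coalg_ops C') (G : coalg_ops E) (G' : coalg_ops E').
Hypotheses (Dc : is_coalgebra D) (Dc' : is_coalgebra D').
Hypotheses (Gc : is_coalgebra G) (Gc' : is_coalgebra G').

Definition tmap (f : C -> E) (g : C' -> E') (z : C \ox C') : E \ox E' :=
  \tsum_(x, y <- z) f x \ot g y.

Lemma tmapE f g x y : lin f -> lin g -> tmap f g (x \ot y) = f x \ot g y.
Proof. by move=> fl gl; rewrite /tmap; flatten. Qed.

Lemma tmap_lin f g : lin f -> lin g -> lin (tmap f g).
Proof. by move=> fl gl; rewrite /tmap; solve_lin. Qed.

Lemma tmap_cmap f g : is_cmap D G f -> is_cmap D' G' g ->
  is_cmap (tensor_coalg D D') (tensor_coalg G G') (tmap f g).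
Proof.
move=> [fl fM fe] [gl gM ge].
have tl := tmap_lin fl gl.
have dl := tensor_comul_lin Dc Dc'; have dl' := tensor_comul_lin Gc Gc'.
have el := tensor_counit_lin Dc Dc'; have el' := tensor_counit_lin Gc Gc'.
split=> //.
  apply: tensor_eq; [by solve_lin | by solve_lin |] => u v.
  rewrite tmapE // !tensor_comul // fM gM.
  expand; symmetry; expand. in_body (rewrite !tmapE //). reorder.
apply: tensor_eqk; [by solve_lin | by solve_lin |] => u v.
by rewrite tmapE // !tensor_counit // fe ge.
Qed.
End TensorMap.

Section TensorCommutes.
Variables (k : fieldType) (C C' V V' : lmodType k).
Variables (D : coalg_ops C) (D' : coalg_ops C').
Hypotheses (Dc : is_coalgebra D) (Dc' : is_coalgebra D').

(** Laziness on one tensor factor survives on the tensor product, the other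
    factor being absorbed by its counit. *)
Lemma commutes_tproj1 (s : C -> k) (g : C -> V) (h : C' -> V') :
  slin s -> lin g -> lin h -> commutes D s g ->
  commutes (tensor_coalg D D') (s \o tproj1 D') (tmap g h).
Proof.
move=> sl gl hl sg; have pl := tproj1_lin (C := C) Dc'; have tl := tmap_lin gl hl.
have cl := tensor_comul_lin Dc Dc'.
have sgx x := congr1 (@^~ x) sg; rewrite /convl /convr in sgx.
apply/funext; rewrite /convl /convr /comp.
apply: tensor_eq; [by solve_lin | by solve_lin |] => x y; rewrite tensor_comul //.
expand. in_body (rewrite (tproj1E Dc') (tmapE _ _ gl hl)). counit Dc'.
symmetry; expand. in_body (rewrite (tproj1E Dc') (tmapE _ _ gl hl)). counit Dc'.
in_body (rewrite scale1r -tensZl); symmetry.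
in_body (rewrite scale1r -tensZl).
have := congr1 (fun v => v \ot h y) (sgx x) => E.
by etransitivity; [|etransitivity; [exact: E|]]; [symmetry|]; flatten.
Qed.

Lemma commutes_tproj2 (s : C' -> k) (g : C -> V) (h : C' -> V') :
  slin s -> lin g -> lin h -> commutes D' s h ->
  commutes (tensor_coalg D D') (s \o tproj2 D) (tmap g h).
Proof.
move=> sl gl hl sg; have pl := tproj2_lin (C' := C') Dc; have tl := tmap_lin gl hl.
have cl := tensor_comul_lin Dc Dc'.
have sgx x := congr1 (@^~ x) sg; rewrite /convl /convr in sgx.
apply/funext; rewrite /convl /convr /comp.
apply: tensor_eq; [by solve_lin | by solve_lin |] => x y; rewrite tensor_comul //.
expand. in_body (rewrite (tproj2E Dc) (tmapE _ _ gl hl)). counit Dc.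
symmetry; expand. in_body (rewrite (tproj2E Dc) (tmapE _ _ gl hl)). counit Dc.
in_body (rewrite scale1r -tensZr); symmetry.
in_body (rewrite scale1r -tensZr).
have := congr1 (fun v => g x \ot v) (sgx y) => E.
by etransitivity; [|etransitivity; [exact: E|]]; [symmetry|]; flatten.
Qed.
End TensorCommutes.

Section TensorAssoc.
Variables (k : fieldType) (C C' C'' : lmodType k).
Variables (D : coalg_ops C) (D' : coalg_ops C') (D'' : coalg_ops C'').
Hypotheses (Dc : is_coalgebra D) (Dc' : is_coalgebra D') (Dc'' : is_coalgebra D'').

Definition tassoc (w : (C \ox C') \ox C'') : C \ox (C' \ox C'') :=
  \tsum_(z, c <- w) \tsum_(a, b <- z) a \ot (b \ot c).

Lemma tassocE a b c : tassoc ((a \ot b) \ot c) = a \ot (b \ot c).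
Proof. rewrite /tassoc; flatten. Qed.

Lemma tassoc_lin : lin tassoc. Proof. rewrite /tassoc; solve_lin. Qed.

Lemma tensor3_eq (W : lmodType k) (f g : (C \ox C') \ox C'' -> W) :
  lin f -> lin g ->
  (forall a b c, f ((a \ot b) \ot c) = g ((a \ot b) \ot c)) ->
  forall w, f w = g w.
Proof.
move=> fl gl fg; apply: tensor_eq => // z c.
by apply: (tensor_eq (f := fun z => f (z \ot c)) (g := fun z => g (z \ot c)))
  => [||a b]; [solve_lin|solve_lin|].
Qed.

Lemma tensor3_eqk (f g : (C \ox C') \ox C'' -> k) :
  slin f -> slin g ->
  (forall a b c, f ((a \ot b) \ot c) = g ((a \ot b) \ot c)) ->
  forall w, f w = g w.
Proof. exact: tensor3_eq. Qed.

Lemma tassoc_cmap : is_cmap (tensor_coalg (tensor_coalg D D') D'')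
  (tensor_coalg D (tensor_coalg D' D'')) tassoc.
Proof.
have al := tassoc_lin.
have d1 := tensor_coalgebra Dc Dc'; have d2 := tensor_coalgebra Dc' Dc''.
have dl := comul_lin (tensor_coalgebra d1 Dc'').
have dl' := comul_lin (tensor_coalgebra Dc d2).
have el := counit_lin (tensor_coalgebra d1 Dc'').
have el' := counit_lin (tensor_coalgebra Dc d2).
split=> //.
  apply: tensor3_eq; [by solve_lin | by solve_lin |] => a b c.
  rewrite tassocE !tensor_comul //; expand; symmetry; expand.
  in_body (rewrite !tassocE). reorder.
apply: tensor3_eqk; [by solve_lin | by solve_lin |] => a b c.
by rewrite tassocE !tensor_counit // mulrA.
Qed.
End TensorAssoc.

(** * Lazy cocycles of a bialgebra *)

Section LazyCocycles.
Variables (k : fieldType) (K : lmodType k) (A : alg_ops K) (D : coalg_ops K).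

(** Bialgebras whose product is a mere operation, as the carrier of the
    biproduct has several of them. *)
Record is_bialg_ops : Prop := IsBialgOps {
  bialg_coalg : is_coalgebra D;
  bialg_mull : forall y, lin (fun x => amul A x y);
  bialg_mulr : forall x, lin (amul A x);
  bialg_mulA : forall x y z, amul A x (amul A y z) = amul A (amul A x y) z;
  bialg_mul1x : forall x, amul A (aone A) x = x;
  bialg_mulx1 : forall x, amul A x (aone A) = x;
  bialg_comul1 : comul D (aone A) = aone A \ot aone A;
  bialg_counit1 : counit D (aone A) = 1;
  bialg_comulM : forall x y, comul D (amul A x y) =
    \tsum_(x1, x2 <- comul D x) \tsum_(y1, y2 <- comul D y)
      amul A x1 y1 \ot amul A x2 y2;
  bialg_counitM : forall x y, counit D (amul A x y) = counit D x * counit D y }.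

Hypothesis HK : is_bialg_ops.
Let Dc := bialg_coalg HK.
Let mull := bialg_mull HK.
Let mulr := bialg_mulr HK.

Local Notation D2 := (tensor_coalg D D).
Local Notation D3 := (tensor_coalg D2 D).
Let D2c : is_coalgebra D2 := tensor_coalgebra Dc Dc.
Let D3c : is_coalgebra D3 := tensor_coalgebra D2c Dc.

Definition mulT (z : K \ox K) : K := \tsum_(x, y <- z) amul A x y.

Lemma mulTE x y : mulT (x \ot y) = amul A x y.
Proof. rewrite /mulT; flatten. Qed.
Lemma mulT_lin : lin mulT. Proof. rewrite /mulT; solve_lin. Qed.
Local Hint Resolve mulT_lin : lin.

Lemma mulT_cmap : is_cmap D2 D mulT.
Proof.
have cl := comul_lin Dc; have el := counit_lin Dc.
have cl2 := comul_lin D2c; have el2 := counit_lin D2c.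
split; first exact: mulT_lin.
  apply: tensor_eq; [by solve_lin | by solve_lin |] => u v.
  rewrite mulTE (bialg_comulM HK) tensor_comul // ; symmetry.
  expand. in_body (rewrite !mulTE). done.
apply: tensor_eqk; [by solve_lin | by solve_lin |] => u v.
by rewrite mulTE tensor_counit // (bialg_counitM HK).
Qed.

Lemma conv2E s t : slin s -> slin t -> conv2 D s t = conv1 D2 s t.
Proof.
move=> sl tl; have cl := comul_lin Dc; have cl2 := comul_lin D2c.
apply/funext; apply: tensor_eqk; [rewrite /conv2; solve_lin | rewrite /conv1; solve_lin |] => u v.
rewrite /conv2 /conv1 tensor_comul //; expand; symmetry; flatten.
Qed.

Lemma counit2E : counit2 D = counit D2. Proof. by []. Qed.

Lemma conv2_inverseE s t : slin s -> conv2_inverse D s t <-> conv1_inverse D2 s t.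
Proof. by move=> sl; split=> -[tl st ts]; split=> //; move: st ts; rewrite !conv2E. Qed.

(** The letter T marks notions stated on tensors, where 2-forms are forms on the
    coalgebra [D2] and the convolution of 2-forms is that of forms. *)
Definition lazyT (s : K \ox K -> k) := commutes D2 s mulT.

Lemma lazy2E s : slin s -> lazy2 A D s <-> lazyT s.
Proof.
move=> sl; have cl := comul_lin Dc; have cl2 := comul_lin D2c.
have El x y : convl D2 s mulT (x \ot y) =
   \tsum_(x1, x2 <- comul D x) \tsum_(y1, y2 <- comul D y)
    s (x1 \ot y1) *: amul A x2 y2.
  by rewrite /convl tensor_comul //; expand; in_body (rewrite mulTE).
have Er x y : convr D2 mulT s (x \ot y) =
   \tsum_(x1, x2 <- comul D x) \tsum_(y1, y2 <- comul D y)
    s (x2 \ot y2) *: amul A x1 y1.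
  by rewrite /convr tensor_comul //; expand; in_body (rewrite mulTE).
split=> [sL|sL x y].
  apply/funext; apply: tensor_eq => [||u v]; last by rewrite El Er; exact: sL.
    exact: convl_lin mulT_lin.
  exact: convr_lin mulT_lin.
by rewrite -El -Er sL.
Qed.

Lemma lazy1E g : lazy1 D g <-> commutes D g (fun x => x).
Proof. by split=> [gL|gL x]; [apply/funext => x; exact: gL|exact: (congr1 (@^~ x) gL)]. Qed.

(** The coalgebra maps from the threefold tensor power to the twofold one whose
    pullbacks turn the cocycle identity into an equation between products. *)
Definition leg12 : (K \ox K) \ox K -> K \ox K := tproj1 D.
Definition leg23 : (K \ox K) \ox K -> K \ox K := tproj2 D \o @tassoc k K K K.
Definition mul12 : (K \ox K) \ox K -> K \ox K := tmap mulT id.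
Definition mul23 : (K \ox K) \ox K -> K \ox K := tmap id mulT \o @tassoc k K K K.

Lemma id_cmap : is_cmap D D id.
Proof. by split=> // c; rewrite tsum_tensE. Qed.

Lemma leg12_cmap : is_cmap D3 D2 leg12. Proof. exact: tproj1_cmap. Qed.
Lemma leg23_cmap : is_cmap D3 D2 leg23.
Proof. by apply: cmap_comp (tassoc_cmap Dc Dc Dc) _; apply: tproj2_cmap. Qed.
Lemma mul12_cmap : is_cmap D3 D2 mul12.
Proof. by apply: tmap_cmap => //; [exact: mulT_cmap | exact: id_cmap]. Qed.
Lemma mul23_cmap : is_cmap D3 D2 mul23.
Proof.
apply: cmap_comp (tassoc_cmap Dc Dc Dc) _.
by apply: tmap_cmap => //; [exact: id_cmap | exact: mulT_cmap].
Qed.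

(** In the convolution algebra of forms on the threefold tensor power:
    [s(x, y) s(x y, z) = s(y, z) s(x, y z)]. *)
Definition cocycleT (s : K \ox K -> k) : Prop :=
  conv1 D3 (s \o leg12) (s \o mul12) = conv1 D3 (s \o leg23) (s \o mul23).

Lemma cocycleE s : slin s ->
  (forall x y z,
    \tsum_(x1, x2 <- comul D x) \tsum_(y1, y2 <- comul D y)
      s (x1 \ot y1) * s (amul A x2 y2 \ot z) =
    \tsum_(y1, y2 <- comul D y) \tsum_(z1, z2 <- comul D z)
      s (y1 \ot z1) * s (x \ot amul A y2 z2)) <-> cocycleT s.
Proof.
move=> sl; have cl := comul_lin Dc; have el := counit_lin Dc.
have cl3 := comul_lin D3c; have cl2 := comul_lin D2c.
have l1 := cmap_lin leg12_cmap; have l2 := cmap_lin leg23_cmap.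
have l3 := cmap_lin mul12_cmap; have l4 := cmap_lin mul23_cmap.
have ml := mulT_lin; have il := @lin_id k K.
have E12 x y z : leg12 (x \ot y \ot z) = counit D z *: (x \ot y).
  exact: tproj1E.
have E23 x y z : leg23 (x \ot y \ot z) = counit D x *: (y \ot z).
  by rewrite /leg23 /= tassocE tproj2E.
have M12 x y z : mul12 (x \ot y \ot z) = amul A x y \ot z.
  by rewrite /mul12 tmapE // mulTE.
have M23 x y z : mul23 (x \ot y \ot z) = x \ot amul A y z.
  by rewrite /mul23 /= tassocE tmapE // mulTE.
have El x y z : conv1 D3 (s \o leg12) (s \o mul12) (x \ot y \ot z) =
   \tsum_(x1, x2 <- comul D x) \tsum_(y1, y2 <- comul D y)
      s (x1 \ot y1) * s (amul A x2 y2 \ot z).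
  rewrite /conv1 !tensor_comul // /comp; cbv beta; expand.
  in_body (rewrite /= E12 M12). counit Dc. by in_body (rewrite scale1r).
have Er x y z : conv1 D3 (s \o leg23) (s \o mul23) (x \ot y \ot z) =
    \tsum_(y1, y2 <- comul D y) \tsum_(z1, z2 <- comul D z)
      s (y1 \ot z1) * s (x \ot amul A y2 z2).
  rewrite /conv1 !tensor_comul // /comp; cbv beta; expand.
  in_body (rewrite /= E23 M23). counit Dc. by in_body (rewrite scale1r).
split=> [sC|sC x y z]; last by rewrite -El -Er sC.
apply/funext; apply: tensor3_eqk => [||x y z]; last by rewrite El Er.
  by apply: conv1_lin => //; apply: lin_comp.
by apply: conv1_lin => //; apply: lin_comp.
Qed.

Local Notation in1 := (fun y : K => aone A \ot y).
Local Notation in2 := (fun x : K => x \ot aone A).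

Lemma in1_cmap : is_cmap D D2 in1.
Proof. exact: (tpair2_cmap Dc Dc (bialg_comul1 HK) (bialg_counit1 HK)). Qed.
Lemma in2_cmap : is_cmap D D2 in2.
Proof. exact: (tpair1_cmap Dc Dc (bialg_comul1 HK) (bialg_counit1 HK)). Qed.

Record lazy_cocycle (s : K \ox K -> k) : Prop := LazyCocycle {
  lc_lin : slin s;
  lc_in1 : s \o in1 = counit D;
  lc_in2 : s \o in2 = counit D;
  lc_cocycle : cocycleT s;
  lc_inv : exists t, conv1_inverse D2 s t;
  lc_lazy : lazyT s }.

Lemma Z2L_E s : Z2L_set A D s <-> lazy_cocycle s.
Proof.
split=> [[[sl sN sC] [t st] sL]|[sl s1 s2 sC [t st] sL]].
  split=> //.
  - by apply/funext => x; case: (sN x).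
  - by apply/funext => x; case: (sN x).
  - exact/cocycleE.
  - by exists t; apply/conv2_inverseE.
  - exact/lazy2E.
split; last exact/lazy2E.
  split=> //; last exact/cocycleE.
  by move=> x; split; [rewrite -s1|rewrite -s2].
by exists t; apply/conv2_inverseE.
Qed.

(** The interchange step behind the multiplicativity of cocycles and of [D1]. *)
Lemma conv1_comp4 (C : lmodType k) (E : coalg_ops C) (a b c d : C -> k) :
  is_coalgebra E -> slin a -> slin b -> slin c -> slin d ->
  conv1 E b c = conv1 E c b ->
  conv1 E (conv1 E a b) (conv1 E c d) = conv1 E (conv1 E a c) (conv1 E b d).
Proof.
move=> Ec al bl cl dl bc; have L := @conv1_lin _ _ _ Ec.
rewrite -!(conv1A Ec) //; try exact: L.
by congr conv1; rewrite !(conv1A Ec) // bc.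
Qed.

(** A lazy form on the first two legs commutes with what only sees their
    product. *)
Lemma lazy_leg12 s (f : K \ox K -> k) : slin s -> slin f -> lazyT s ->
  conv1 D3 (s \o leg12) (f \o mul12) = conv1 D3 (f \o mul12) (s \o leg12).
Proof.
move=> sl fl sL; suff sL3 : commutes D3 (s \o leg12) mul12.
  exact: commutes_conv1 (commutes_comp fl sL3).
by apply: commutes_tproj1 => //; exact: mulT_lin.
Qed.

Lemma lazy_leg23 s (f : K \ox K -> k) : slin s -> slin f -> lazyT s ->
  conv1 D3 (s \o leg23) (f \o mul23) = conv1 D3 (f \o mul23) (s \o leg23).
Proof.
move=> sl fl sL; suff sL3 : commutes D3 (s \o leg23) mul23.
  exact: commutes_conv1 (commutes_comp fl sL3).
have pl := tproj2_lin (C' := Defs_tensor__canonical__GRing_Lmodule K K) Dc.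
have tl : lin (tmap id mulT : K \ox (K \ox K) -> K \ox K).
  by apply: tmap_lin => //; exact: mulT_lin.
suff sL3 : commutes (tensor_coalg D D2) (s \o tproj2 D) (tmap id mulT).
  exact: commutes_cmap (tassoc_cmap Dc Dc Dc) (slin_comp sl pl) tl sL3.
by apply: commutes_tproj2 => //; exact: mulT_lin.
Qed.

Lemma lazy_cocycle1 : lazy_cocycle (counit D2).
Proof.
have el := counit_lin D2c.
split=> //.
- by rewrite (counit_cmap in1_cmap).
- by rewrite (counit_cmap in2_cmap).
- rewrite /cocycleT (counit_cmap leg12_cmap) (counit_cmap leg23_cmap).
  by rewrite (counit_cmap mul12_cmap) (counit_cmap mul23_cmap).
- by exists (counit D2); exact: conv1_inverse1.
exact: commutes1 mulT_lin.
Qed.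

(** The factor [t(x, y)] of the product has to be moved past [s(x y, z)], and
    [t(y, z)] past [s(x, y z)]; laziness of [t] allows both. *)
Lemma lazy_cocycleM s t : lazy_cocycle s -> lazy_cocycle t ->
  lazy_cocycle (conv1 D2 s t).
Proof.
move=> [sl s1 s2 sC [s' ss'] sL] [tl t1 t2 tC [t' tt'] tL].
have [el e2l] := (counit_lin Dc, counit_lin D2c).
split; first exact: conv1_lin.
- by rewrite -(conv1_cmap in1_cmap) // s1 t1 conv1e.
- by rewrite -(conv1_cmap in2_cmap) // s2 t2 conv1e.
- rewrite /cocycleT -!(conv1_cmap leg12_cmap) // -!(conv1_cmap mul12_cmap) //.
  rewrite -!(conv1_cmap leg23_cmap) // -!(conv1_cmap mul23_cmap) //.
  have [l1 l2] := (cmap_lin leg12_cmap, cmap_lin leg23_cmap).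
  have [l3 l4] := (cmap_lin mul12_cmap, cmap_lin mul23_cmap).
  rewrite conv1_comp4 ?(lazy_leg12 tl sl tL) //; try exact: slin_comp.
  rewrite [RHS]conv1_comp4 ?(lazy_leg23 tl sl tL) //; try exact: slin_comp.
  by rewrite sC tC.
- by exists (conv1 D2 t' s'); exact: conv1_inverse_mul.
by apply: commutesM => //; exact: mulT_lin.
Qed.

(** Inverting the cocycle identity of [s] reverses the order of the factors;
    laziness of [t] restores it. *)
Lemma lazy_cocycleV s t : lazy_cocycle s -> conv1_inverse D2 s t ->
  lazy_cocycle t.
Proof.
move=> [sl s1 s2 sC _ sL] st; have [tl _ _] := st.
have inj i : is_cmap D D2 i -> s \o i = counit D -> t \o i = counit D.
  move=> im si; have := conv1_inverse_cmap im sl st; rewrite si => ti.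
  exact: (conv1_inverse_unique Dc (counit_lin Dc) ti (conv1_inverse1 Dc)).
split=> //.
- exact: inj in1_cmap s1.
- exact: inj in2_cmap s2.
- rewrite /cocycleT.
  have [l1 l2] := (cmap_lin leg12_cmap, cmap_lin leg23_cmap).
  have [l3 l4] := (cmap_lin mul12_cmap, cmap_lin mul23_cmap).
  have tL : lazyT t by apply: commutesV st sL => //; exact: mulT_lin.
  rewrite (lazy_leg12 tl tl tL) (lazy_leg23 tl tl tL).
  have I f fm := @conv1_inverse_cmap _ _ _ D3 D2 f s t fm sl st.
  have E1 := conv1_inverse_mul D3c (slin_comp sl l1) (slin_comp sl l3)
    (I _ leg12_cmap) (I _ mul12_cmap).
  have E2 := conv1_inverse_mul D3c (slin_comp sl l2) (slin_comp sl l4)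
    (I _ leg23_cmap) (I _ mul23_cmap).
  rewrite sC in E1; apply: conv1_inverse_unique E1 E2 => //.
  by apply: conv1_lin => //; exact: slin_comp.
- by exists s; exact: conv1_inverse_sym.
by apply: commutesV st sL => //; exact: mulT_lin.
Qed.

Theorem Z2L_group : is_group (Z2L A D).
Proof.
have M s t : Z2L_set A D s -> Z2L_set A D t -> conv2 D s t = conv1 D2 s t.
  by move=> /Z2L_E zs /Z2L_E zt; apply: conv2E; exact: lc_lin.
have Z1 : Z2L_set A D (counit2 D) by apply/Z2L_E; exact: lazy_cocycle1.
have ZM s t : Z2L_set A D s -> Z2L_set A D t -> Z2L_set A D (conv2 D s t).
  move=> zs zt; rewrite M //; apply/Z2L_E; apply: lazy_cocycleM; exact/Z2L_E.
split=> //= [s t u zs zt zu|s zs|s zs|s zs].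
- have ZM' s' t' : Z2L_set A D s' -> Z2L_set A D t' ->
      Z2L_set A D (conv1 D2 s' t') by move=> zs' zt'; rewrite -M //; exact: ZM.
  rewrite !M //; try exact: ZM'.
  by apply: conv1A => //; apply: lc_lin; exact/Z2L_E.
- by rewrite M // counit2E conv1e //; apply: lc_lin; exact/Z2L_E.
- by rewrite M // counit2E conve1 //; apply: lc_lin; exact/Z2L_E.
have /Z2L_E ls := zs; have [t st] := lc_inv ls; have [tl tE Et] := st.
have zt : Z2L_set A D t by apply/Z2L_E; exact: lazy_cocycleV ls st.
by exists t => //; rewrite !M.
Qed.

(** [D1] of [g] with its inverse [g'] as an argument: the product of the forms
    [g(x)], [g(y)] and [g'(x y)]. *)
Definition D1T (g g' : K -> k) : K \ox K -> k :=
  conv1 D2 (conv1 D2 (g \o tproj1 D) (g \o tproj2 D)) (g' \o mulT).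

Let p1 := tproj1_cmap Dc Dc.
Let p2 := tproj2_cmap Dc Dc.
Let p1l := cmap_lin p1.
Let p2l := cmap_lin p2.
Let ml := mulT_lin.

Lemma convTE (s t : K -> k) x y : slin s -> slin t ->
  conv1 D2 (s \o tproj1 D) (t \o tproj2 D) (x \ot y) = s x * t y.
Proof.
move=> sl tl; rewrite /conv1 tensor_comul // /comp; expand.
in_body (rewrite (tproj1E Dc) (tproj2E Dc)). counit Dc. counit Dc.
by rewrite !scale1r.
Qed.

Lemma D1E g g' : slin g -> conv1_inverse D g g' -> D1 A D g = D1T g g'.
Proof.
move=> gl gg'; have [gl' _ _] := gg'.
have cl := comul_lin Dc; have cl2 := comul_lin D2c.
have pl : slin (conv1 D2 (g \o tproj1 D) (g \o tproj2 D)).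
  by apply: conv1_lin => //; exact: slin_comp.
rewrite /D1 /D1T (conv1_invE Dc gl gg') [RHS]/conv1 /comp.
apply/funext; apply: tensor_eqk; [by solve_lin | by solve_lin |] => u v.
rewrite tensor_comul //; expand; symmetry; expand.
in_body (rewrite (convTE _ _ gl gl) mulTE). reorder.
Qed.

(** A lazy form commutes with the identity, hence with every form. *)
Lemma lazy1_central (C : lmodType k) (E : coalg_ops C) (g f : C -> k) :
  slin f -> commutes E g (fun x => x) -> conv1 E g f = conv1 E f g.
Proof. by move=> fl gc; exact: commutes_conv1 (commutes_comp fl gc). Qed.

Lemma tmap_id (C C' : lmodType k) : tmap id id = id :> (C \ox C' -> C \ox C').
Proof. by apply/funext => z; exact: tsum_tensE. Qed.

Lemma lazy1_tproj1 (C C' : lmodType k) (E : coalg_ops C) (E' : coalg_ops C')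
    (g : C -> k) : is_coalgebra E -> is_coalgebra E' -> slin g ->
  commutes E g (fun x => x) ->
  commutes (tensor_coalg E E') (g \o tproj1 E') (fun x => x).
Proof.
move=> Ec Ec' gl gc.
have := commutes_tproj1 Ec Ec' gl (@lin_id k C) (@lin_id k C') gc.
by rewrite tmap_id.
Qed.

Lemma lazy1_tproj2 (C C' : lmodType k) (E : coalg_ops C) (E' : coalg_ops C')
    (g : C' -> k) : is_coalgebra E -> is_coalgebra E' -> slin g ->
  commutes E' g (fun x => x) ->
  commutes (tensor_coalg E E') (g \o tproj2 E) (fun x => x).
Proof.
move=> Ec Ec' gl gc.
have := commutes_tproj2 Ec Ec' gl (@lin_id k C) (@lin_id k C') gc.
by rewrite tmap_id.
Qed.

Section CoboundaryForm.
Variables g g' : K -> k.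
Hypotheses (gl : slin g) (g1 : g (aone A) = 1) (gg' : conv1_inverse D g g').

Let gl' : slin g'. Proof. by case: gg'. Qed.

Lemma conv1_inverse_one : g' (aone A) = 1.
Proof.
have [_ + _] := gg' => /(congr1 (@^~ (aone A))).
rewrite /conv1 (bialg_comul1 HK) (bialg_counit1 HK) => <-; symmetry.
by etransitivity; [flatten|]; rewrite g1 mul1r.
Qed.

Lemma lazy1_inverse : lazy1 D g -> lazy1 D g'.
Proof.
move=> /lazy1E gL; apply/lazy1E; apply: commutesV gg' gL => //.
Qed.

Lemma D1T_lin : slin (D1T g g').
Proof.
rewrite /D1T.
by do 2?[apply: conv1_lin => //]; exact: slin_comp.
Qed.

Lemma D1T_inverse : conv1_inverse D2 (D1T g g')
  (conv1 D2 (g \o mulT) (conv1 D2 (g' \o tproj2 D) (g' \o tproj1 D))).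
Proof.
apply: conv1_inverse_mul => //; try exact: slin_comp.
- by apply: conv1_lin => //; exact: slin_comp.
- have I1 := conv1_inverse_cmap p1 gl gg'; have I2 := conv1_inverse_cmap p2 gl gg'.
  exact: (conv1_inverse_mul D2c (slin_comp gl p1l) (slin_comp gl p2l) I1 I2).
exact: (conv1_inverse_cmap mulT_cmap gl' (conv1_inverse_sym gl gg')).
Qed.

Lemma D1T_in1 : D1T g g' \o in1 = counit D.
Proof.
have [_ E _] := gg'.
rewrite /D1T -!(conv1_cmap in1_cmap) //; try (by apply: conv1_lin => //; exact: slin_comp);
  try exact: slin_comp.
have -> : (g \o tproj1 D) \o in1 = counit D.
  apply/funext => x /=; rewrite (tproj1E Dc) (linZ gl) g1.
  exact: mulr1.
have -> : (g \o tproj2 D) \o in1 = g.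
  by apply/funext => x /=; rewrite (tproj2E Dc) (bialg_counit1 HK) scale1r.
have -> : (g' \o mulT) \o in1 = g'.
  by apply/funext => x /=; rewrite mulTE (bialg_mul1x HK).
by rewrite conv1e.
Qed.

Lemma D1T_in2 : D1T g g' \o in2 = counit D.
Proof.
have [_ E _] := gg'.
rewrite /D1T -!(conv1_cmap in2_cmap) //; try (by apply: conv1_lin => //; exact: slin_comp);
  try exact: slin_comp.
have -> : (g \o tproj2 D) \o in2 = counit D.
  apply/funext => x /=; rewrite (tproj2E Dc) (linZ gl) g1.
  exact: mulr1.
have -> : (g \o tproj1 D) \o in2 = g.
  by apply/funext => x /=; rewrite (tproj1E Dc) (bialg_counit1 HK) scale1r.
have -> : (g' \o mulT) \o in2 = g'.
  by apply/funext => x /=; rewrite mulTE (bialg_mulx1 HK).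
by rewrite conve1.
Qed.

Hypothesis gL : lazy1 D g.
Let gC : commutes D g (fun x => x). Proof. exact/lazy1E. Qed.
Let gC' : commutes D g' (fun x => x). Proof. exact/lazy1E/lazy1_inverse. Qed.

(** The forms [g(x)] and [g(y)] are lazy on the tensor square; [g'(x y)] is the
    pullback along the product of a lazy form. *)
Lemma D1T_lazy : lazyT (D1T g g').
Proof.
apply: commutesM => //; try exact: slin_comp.
- by apply: conv1_lin => //; exact: slin_comp.
- apply: commutesM => //; try exact: slin_comp.
  + have := commutes_comp ml (lazy1_tproj1 Dc Dc gl gC); exact.
  + have := commutes_comp ml (lazy1_tproj2 Dc Dc gl gC); exact.
by have := commutes_cmap mulT_cmap gl' (@lin_id k K) gC'.
Qed.

(** [g(x)] and [g(y)] are central, and a lazy [s] commutes with [g'(x y)], which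
    factors through the product. *)
Lemma D1T_central s : slin s -> lazyT s ->
  conv1 D2 (D1T g g') s = conv1 D2 s (D1T g g').
Proof.
move=> sl sL.
have [l1 l2] := (slin_comp gl p1l, slin_comp gl p2l).
have l3 := slin_comp gl' ml; have L := @conv1_lin _ _ _ D2c.
have C3 : conv1 D2 s (g' \o mulT) = conv1 D2 (g' \o mulT) s.
  exact: commutes_conv1 (commutes_comp gl' sL).
have C1 := lazy1_central sl (lazy1_tproj1 Dc Dc gl gC).
have C2 := lazy1_central sl (lazy1_tproj2 Dc Dc gl gC).
rewrite /D1T -conv1A // -?C3 ?conv1A //; try exact: L.
by rewrite -(conv1A _ l1 l2 sl) // C2 conv1A // C1 -(conv1A _ sl l1 l2).
Qed.

End CoboundaryForm.

End LazyCocycles.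

(** * Quotients by central subgroups *)

Section CentralQuotient.
Local Open Scope classical_set_scope.
Variables (T : Type) (G : group_ops T).

(** Centrality is what makes the quotient easy: cosets multiply elementwise. *)
Record is_central_subgroup (N : set T) : Prop := IsCentralSubgroup {
  central_sub : N `<=` carrier G;
  central_one : N (gone G);
  central_mul : forall x y, N x -> N y -> N (gmul G x y);
  central_inv : forall x, N x -> exists2 y, N y &
    gmul G x y = gone G /\ gmul G y x = gone G;
  centralC : forall x n, carrier G x -> N n -> gmul G n x = gmul G x n }.

Hypothesis HG : is_group G.
Variable N : set T.
Hypothesis HN : is_central_subgroup N.

Let NG n : N n -> carrier G n. Proof. exact: (central_sub HN). Qed.
Let GM := gmul_in HG.

Lemma coset_mul x y : carrier G x -> carrier G y ->
  gmul (quotient_ops G N) (coset G N x) (coset G N y) = coset G N (gmul G x y).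
Proof.
move=> Gx Gy; apply/seteqP; split=> [_ [_ [n Nn <-] [_ [m Nm <-] <-]]|_ [n Nn <-]].
  exists (gmul G n m); first exact: (central_mul HN).
  have [Gn Gm] := (NG Nn, NG Nm).
  rewrite -!(gmulA HG) //; try by do ?apply: GM.
  by congr gmul; rewrite !(gmulA HG) // (centralC HN Gy Nn).
exists x; first by exists (gone G); [exact: (central_one HN) | rewrite (gmulx1 HG)].
exists (gmul G y n); first by exists n.
by rewrite (gmulA HG) //; exact: NG.
Qed.

Lemma quotient_group : is_group (quotient_ops G N).
Proof.
have G1 := gone_in HG.
split.
- by exists (gone G).
- by move=> _ _ [x Gx <-] [y Gy <-]; exists (gmul G x y); rewrite ?coset_mul //; apply: GM.
- move=> _ _ _ [x Gx <-] [y Gy <-] [z Gz <-].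
  by rewrite !coset_mul ?(gmulA HG) //; apply: GM.
- by move=> _ [x Gx <-]; rewrite [gone _]/(coset _ _ _) coset_mul // (gmul1x HG).
- by move=> _ [x Gx <-]; rewrite [gone _]/(coset _ _ _) coset_mul // (gmulx1 HG).
move=> _ [x Gx <-]; have [y Gy [xy yx]] := ginv_ex HG Gx.
by exists (coset G N y); [exists y | rewrite !coset_mul // xy yx].
Qed.
End CentralQuotient.

(** The induced map sends a coset [X] to the union of the cosets of [f x] for [x]
    in [X], which avoids choosing a representative. *)
Lemma quotient_hom (T T' : Type) (G : group_ops T) (G' : group_ops T')
    (N : set T) (N' : set T') (f : T -> T') :
  is_group_hom G G' f -> is_central_subgroup G N -> is_central_subgroup G' N' ->
  (forall n, N n -> N' (f n)) ->
  exists F, is_group_hom (quotient_ops G N) (quotient_ops G' N') F /\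
    forall x, carrier G x -> F (coset G N x) = coset G' N' (f x).
Proof.
move=> [HG HG' fG fM] HN HN' fN.
pose F (X : set T) : set T' := [set gmul G' (f x) n | x in X & n in N']%classic.
have FE x : carrier G x -> F (coset G N x) = coset G' N' (f x).
  move=> Gx; apply/seteqP; split=> [_ [_ [n Nn <-] [m Nm <-]]|_ [n Nn <-]].
    have [Gn Gm] := (central_sub HN Nn, central_sub HN' Nm).
    exists (gmul G' (f n) m); first by apply: (central_mul HN') => //; exact: fN.
    by rewrite fM // (gmulA HG') //; apply: fG.
  exists x; last by exists n.
  by exists (gone G); [exact: (central_one HN) | rewrite (gmulx1 HG)].
exists F; split=> //; split; [exact: quotient_group | exact: quotient_group | |].
  by move=> _ [x Gx <-]; rewrite FE //; exists (f x) => //; exact: fG.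
move=> _ _ [x Gx <-] [y Gy <-].
by rewrite coset_mul // !FE // ?coset_mul ?fM //; [exact: fG | exact: fG | exact: (gmul_in HG)].
Qed.

(** * Lazy coboundaries of a bialgebra *)

Section Coboundaries.
Variables (k : fieldType) (K : lmodType k) (A : alg_ops K) (D : coalg_ops K).
Hypothesis HK : is_bialg_ops A D.
Let Dc := bialg_coalg HK.

Local Notation D2 := (tensor_coalg D D).
Local Notation D3 := (tensor_coalg D2 D).
Let D2c : is_coalgebra D2 := tensor_coalgebra Dc Dc.
Let D3c : is_coalgebra D3 := tensor_coalgebra D2c Dc.
Let p1 := tproj1_cmap Dc Dc.
Let p2 := tproj2_cmap Dc Dc.
Let q1 := tproj1_cmap D2c Dc.
Let q2 := tproj2_cmap D2c Dc.
Let m := mulT_cmap HK.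
Let ml := mulT_lin HK.
Let L := @conv1_lin _ _ _ D2c.

(** Let [gi], [gij], [gijk] be [g] applied to the product of the indicated legs,
    and put a prime for the inverse of [g].
    The left side is [g1 g2 g12' g12 g3 g123'] and the right side is
    [g2 g3 g23' g1 g23 g123']; after cancellation, with [g1] central by laziness,
    both are [g1 g2 g3 g123']. *)
Lemma D1T_cocycle g g' : slin g -> conv1_inverse D g g' -> lazy1 D g ->
  cocycleT A D (D1T A D g g').
Proof.
move=> gl gg' /lazy1E gC; have [gl' _ _] := gg'.
have [p1l p2l] := (cmap_lin p1, cmap_lin p2).
have [q1l q2l] := (cmap_lin q1, cmap_lin q2).
have al := @tassoc_lin k K K K.
have il := @lin_id k K.
have [l1 l2] := (cmap_lin (leg12_cmap HK), cmap_lin (leg23_cmap HK)).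
have [l3 l4] := (cmap_lin (mul12_cmap HK), cmap_lin (mul23_cmap HK)).
have E12 x y z : leg12 D (x \ot y \ot z) = counit D z *: (x \ot y).
  exact: tproj1E.
have E23 x y z : leg23 D (x \ot y \ot z) = counit D x *: (y \ot z).
  by rewrite /leg23 /= tassocE tproj2E.
have M12 x y z : mul12 A (x \ot y \ot z) = amul A x y \ot z.
  by rewrite /mul12 tmapE // (mulTE HK).
have M23 x y z : mul23 A (x \ot y \ot z) = x \ot amul A y z.
  by rewrite /mul23 /= tassocE tmapE // (mulTE HK).
have sl (f : K -> k) (h : (K \ox K) \ox K -> K) : slin f -> lin h ->
    slin (f \o h) by exact: slin_comp.
pose t1 := tproj1 D \o leg12 D; pose t2 := tproj2 D \o leg12 D.
pose t3 : (K \ox K) \ox K -> K := tproj2 D2.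
pose t12 := mulT A \o leg12 D; pose t23 := mulT A \o leg23 D.
pose t123 := mulT A \o mul12 A.
have ext (f h : (K \ox K) \ox K -> K) : lin f -> lin h ->
    (forall a b c, f (a \ot b \ot c) = h (a \ot b \ot c)) -> f = h.
  by move=> fl hl fh; apply/funext; exact: tensor3_eq.
have t1l : lin t1 by exact: lin_comp.
have t2l : lin t2 by exact: lin_comp.
have t12l : lin t12 by exact: lin_comp.
have t23l : lin t23 by exact: lin_comp.
have t123l : lin t123 by exact: lin_comp.
have e1 : tproj1 D \o mul12 A = t12.
  apply: ext => [||a b c] //; first exact: lin_comp.
  by rewrite /t12 /= M12 E12 (tproj1E Dc) (linZ ml) (mulTE HK).
have e2 : tproj2 D \o mul12 A = t3.
  apply: ext => [||a b c] //; first exact: lin_comp.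
  rewrite /t3 /= M12 (tproj2E Dc) (tproj2E D2c) (bialg_counitM HK).
  by rewrite tensor_counit.
have e3 : tproj1 D \o leg23 D = t2.
  apply: ext => [||a b c] //; first exact: lin_comp.
  rewrite /t2 /= E12 E23 (linZ p1l) (linZ p2l) (tproj1E Dc) (tproj2E Dc).
  by rewrite !scalerA mulrC.
have e4 : tproj2 D \o leg23 D = t3.
  apply: ext => [||a b c] //; first exact: lin_comp.
  rewrite /t3 /= E23 (linZ p2l) (tproj2E Dc) (tproj2E D2c) tensor_counit //.
  by rewrite scalerA.
have e5 : tproj1 D \o mul23 A = t1.
  apply: ext => [||a b c] //; first exact: lin_comp.
  rewrite /t1 /= E12 M23 (linZ p1l) !(tproj1E Dc) (bialg_counitM HK).
  by rewrite scalerA mulrC.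
have e6 : tproj2 D \o mul23 A = t23.
  apply: ext => [||a b c] //; first exact: lin_comp.
  by rewrite /t23 /= M23 E23 (tproj2E Dc) (linZ ml) (mulTE HK).
have e7 : mulT A \o mul23 A = t123.
  apply: ext => [||a b c] //; first exact: lin_comp.
  by rewrite /t123 /= M23 M12 !(mulTE HK) (bialg_mulA HK).
have S i : is_cmap D3 D2 i -> D1T A D g g' \o i =
    conv1 D3 (conv1 D3 (g \o (tproj1 D \o i)) (g \o (tproj2 D \o i)))
             (g' \o (mulT A \o i)).
  move=> im; have [s1 s2] := (slin_comp gl p1l, slin_comp gl p2l).
  have s3 := slin_comp gl' ml.
  by rewrite /D1T -(conv1_cmap im (L s1 s2) s3) -(conv1_cmap im s1 s2).
have M (s t : (K \ox K) \ox K -> k) : slin s -> slin t -> slin (conv1 D3 s t).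
  exact: conv1_lin.
rewrite /cocycleT !S; try exact: (leg12_cmap HK); try exact: (leg23_cmap HK);
  try exact: (mul12_cmap HK); try exact: (mul23_cmap HK).
rewrite e1 e2 e3 e4 e5 e6 e7 -/t1 -/t2 -/t12 -/t23 -/t123.
have G1 := sl _ _ gl t1l; have G2 := sl _ _ gl t2l.
have G3 : slin (g \o t3) := sl _ _ gl q2l.
have [G12 G12'] := (sl _ _ gl t12l, sl _ _ gl' t12l).
have [G23 G23'] := (sl _ _ gl t23l, sl _ _ gl' t23l).
have G123' := sl _ _ gl' t123l.
have [_ _ I12] := conv1_inverse_cmap (cmap_comp (leg12_cmap HK) m) gl gg'.
have [_ _ I23] := conv1_inverse_cmap (cmap_comp (leg23_cmap HK) m) gl gg'.
have C1 f : slin f -> conv1 D3 (g \o t1) f = conv1 D3 f (g \o t1).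
  move=> fl; apply: lazy1_central fl _.
  have := lazy1_tproj1 D2c Dc (slin_comp gl p1l) (lazy1_tproj1 Dc Dc gl gC).
  exact.
have cancel P u v c d : slin P -> slin u -> slin v -> slin c -> slin d ->
    conv1 D3 v u = counit D3 ->
    conv1 D3 (conv1 D3 P v) (conv1 D3 (conv1 D3 u c) d) =
    conv1 D3 (conv1 D3 P c) d.
  move=> Pl ul vl cl dl vu.
  have [uc Pv] := (M _ _ ul cl, M _ _ Pl vl).
  by rewrite conv1A // [conv1 D3 (conv1 D3 P v) _]conv1A // -(conv1A _ Pl) // vu conve1.
rewrite cancel //; try exact: M; rewrite (C1 _ G23) cancel //; try exact: M.
by rewrite -(C1 _ (M _ _ G2 G3)) conv1A.
Qed.

Section Mul.
Variables (g g' f f' : K -> k).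
Hypotheses (gl : slin g) (fl : slin f).
Hypotheses (gg' : conv1_inverse D g g') (ff' : conv1_inverse D f f').
Hypotheses (fL : lazy1 D f).

(** The forms [f(x)] and [f(y)] are central and can be gathered with [g(x)] and
    [g(y)]. *)
Lemma D1T_mul :
  conv1 D2 (D1T A D g g') (D1T A D f f') =
  D1T A D (conv1 D g f) (conv1 D g' f').
Proof.
have [gl' _ _] := gg'; have [fl' _ _] := ff'.
have [p1l p2l] := (cmap_lin p1, cmap_lin p2).
have fC : commutes D f (fun x => x) by exact/lazy1E.
have [g1 g2] := (slin_comp gl p1l, slin_comp gl p2l).
have [f1 f2] := (slin_comp fl p1l, slin_comp fl p2l).
have [gm fm] := (slin_comp gl' ml, slin_comp fl' ml).
have F2 s : slin s -> conv1 D2 (f \o tproj2 D) s = conv1 D2 s (f \o tproj2 D).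
  by move=> sl; apply: lazy1_central sl (lazy1_tproj2 Dc Dc fl fC).
have F1 s : slin s -> conv1 D2 (f \o tproj1 D) s = conv1 D2 s (f \o tproj1 D).
  by move=> sl; apply: lazy1_central sl (lazy1_tproj1 Dc Dc fl fC).
rewrite /D1T conv1_comp4 //; try exact: L; last first.
  by rewrite -[RHS]conv1A // (F2 _ gm) [RHS]conv1A // (F1 _ gm) -conv1A.
rewrite (conv1_comp4 _ g1 g2 f1 f2) // ?F1 //.
by rewrite !(conv1_cmap p1) // !(conv1_cmap p2) // !(conv1_cmap m).
Qed.
End Mul.

Lemma D1T_counit : D1T A D (counit D) (counit D) = counit D2.
Proof.
have el := counit_lin D2c.
by rewrite /D1T (counit_cmap p1) (counit_cmap p2) (counit_cmap m) !conv1e.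
Qed.

Lemma B2L_E s : B2L_set A D s <->
  exists g g', [/\ slin g, g (aone A) = 1, conv1_inverse D g g', lazy1 D g
                 & s = D1T A D g g'].
Proof.
split=> [[g [gl g1 [g' gg'] gL ->]]|[g [g' [gl g1 gg' gL ->]]]].
  by exists g, g'; split=> //; exact: D1E.
by exists g; split=> //; [exists g' | rewrite (D1E HK gl gg')].
Qed.

Lemma lazy_coboundary g g' : slin g -> g (aone A) = 1 ->
  conv1_inverse D g g' -> lazy1 D g -> lazy_cocycle A D (D1T A D g g').
Proof.
move=> gl g1 gg' gL; split; [exact: D1T_lin | exact: D1T_in1 | exact: D1T_in2 | | |].
- exact: D1T_cocycle.
- by eexists; exact: D1T_inverse.
exact: D1T_lazy.
Qed.

Theorem B2L_central : is_central_subgroup (Z2L A D) (B2L_set A D).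
Proof.
have sub s : B2L_set A D s -> Z2L_set A D s.
  move=> /(B2L_E _)[g [g' [gl g1 gg' gL ->]]]; apply/(Z2L_E HK).
  exact: lazy_coboundary.
have M s t : B2L_set A D s -> B2L_set A D t -> conv2 D s t = conv1 D2 s t.
  move=> /sub/(Z2L_E HK) zs /sub/(Z2L_E HK) zt.
  exact: (conv2E HK (lc_lin zs) (lc_lin zt)).
have Bmul s t : B2L_set A D s -> B2L_set A D t -> B2L_set A D (conv2 D s t).
  move=> Bs Bt; rewrite M //.
  move: Bs Bt => /(B2L_E _)[g [g' [gl g1 gg' gL ->]]] /(B2L_E _)[f [f' [fl f1 ff' fL ->]]].
  apply/B2L_E; exists (conv1 D g f), (conv1 D g' f').
  have [gl' _ _] := gg'; have [fl' _ _] := ff'.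
  split; [exact: conv1_lin | | | |exact: D1T_mul].
  - rewrite /conv1 (bialg_comul1 HK).
    by etransitivity; [flatten|]; rewrite g1 f1 mulr1.
  - have -> : conv1 D g' f' = conv1 D f' g'.
      by symmetry; apply: lazy1_central => //; exact/lazy1E/(lazy1_inverse HK fl ff').
    exact: conv1_inverse_mul.
  by apply/lazy1E; apply: commutesM => //; exact/lazy1E.
have Bone : B2L_set A D (gone (Z2L A D)).
  apply/B2L_E; exists (counit D), (counit D); split=> //.
  - exact: counit_lin.
  - exact: (bialg_counit1 HK).
  - exact: conv1_inverse1.
  - by apply/lazy1E; exact: commutes1.
  by rewrite D1T_counit.
split=> //.
- move=> s Bs; have /(B2L_E _)[g [g' [gl g1 gg' gL sE]]] := Bs.
  have [gl' E E'] := gg'; have gL' := lazy1_inverse HK gl gg' gL.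
  have g'g := conv1_inverse_sym gl gg'.
  have Bt : B2L_set A D (D1T A D g' g).
    apply/B2L_E; exists g', g; split=> //.
    exact: (conv1_inverse_one HK gl g1 gg').
  exists (D1T A D g' g) => //; rewrite /= !M // sE !D1T_mul //.
  by rewrite E E' D1T_counit.
move=> s n zs Bn; have zn := sub n Bn.
have /(Z2L_E HK) ls := zs; have /(Z2L_E HK) ln := zn.
have [sl nl] := (lc_lin ls, lc_lin ln); rewrite /= !(conv2E HK) //.
have sL := lc_lazy ls.
move: Bn => /(B2L_E _)[g [g' [gl g1 gg' gL ->]]].
exact: D1T_central.
Qed.

(** The counit recovers the cocycle from the twisted product, hence uniqueness
    of a cocycle with a given twisted product. *)
Lemma counit_twist s x y : slin s ->
  counit D (amul (twist_alg A D s) x y) = s (x \ot y).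
Proof.
move=> sl; have el := counit_lin Dc; rewrite [amul _ _ _]/=.
expand. in_body (rewrite (linZ el) (bialg_counitM HK)). counit Dc. counit Dc.
by rewrite mulr1; exact: mulr1.
Qed.

Lemma twist_alg_inj s t : slin s -> slin t ->
  twist_alg A D s = twist_alg A D t -> s = t.
Proof.
move=> sl tl st; apply/funext; apply: tensor_eqk => // x y.
by rewrite -!counit_twist // st.
Qed.

End Coboundaries.

(** * The axioms of an admissible pair under a sum *)

Section Rules.
Variables (k : fieldType) (H B : algType k) (P : pair_ops H B).
Hypothesis HP : is_admissible P.

Local Notation DH := (comul (coalgH P)).
Local Notation eH := (counit (coalgH P)).
Local Notation DB := (comul (coalgB P)).
Local Notation eB := (counit (coalgB P)).
Local Notation "h |> b" := (act P h b) (at level 35, right associativity).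
Local Notation rho := (coact P).

Let HB := adm_bialgebraH HP.
Lemma admH : is_coalgebra (coalgH P). Proof. exact: bialgebra_coalgebra HB. Qed.
Lemma admB : is_coalgebra (coalgB P). Proof. exact: adm_coalgebraB HP. Qed.

Lemma act_linl b : lin (fun h => h |> b).
Proof. exact: (act_bilinear (adm_module HP)).1. Qed.
Lemma act_linr h : lin (act P h).
Proof. exact: (act_bilinear (adm_module HP)).2. Qed.
Lemma act_mul (g h : H) b : (g * h) |> b = g |> h |> b.
Proof. exact (actM (adm_module HP) g h b). Qed.
Lemma rho_lin : lin rho. Proof. exact: (coact_linear (adm_comodule HP)). Qed.

Let Hc := admH.
Let Bc := admB.
Let DHl := comul_lin Hc.
Let DBl := comul_lin Bc.
Let eHl := counit_lin Hc.
Let eBl := counit_lin Bc.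
Let al := act_linl.
Let ar := act_linr.
Let rl := rho_lin.

Variable W : lmodType k.

(** The axioms of an admissible pair that are equalities of tensors become rules
    for sums with an arbitrary multilinear summand. *)
Lemma rho_coassoc_sum b (F : H -> H -> B -> W) E :
  (forall x b0, E x b0 = tsum (DH x) (fun x1 x2 => F x1 x2 b0)) ->
  (forall y c, lin (fun x => F x y c)) -> (forall x c, lin (fun y => F x y c)) ->
  (forall x y, lin (fun c => F x y c)) ->
  tsum (rho b) E = \tsum_(x, b0 <- rho b) \tsum_(y, b00 <- rho b0) F x y b00.
Proof.
move=> EF F1 F2 F3; rewrite (eq_tsum _ EF).
have := congr1 (fun t : H \ox (H \ox B) =>
  tsum t (fun a s => tsum s (fun b c => F a b c))) (coact_coassoc (adm_comodule HP) b).
by move=> R; etransitivity; [|etransitivity; [exact: R|]]; [symmetry|]; flatten.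
Qed.

Lemma rho_coassoc_sum_rev b (F : H -> H -> B -> W) E :
  (forall x b0, E x b0 = tsum (rho b0) (fun y b00 => F x y b00)) ->
  (forall y c, lin (fun x => F x y c)) -> (forall x c, lin (fun y => F x y c)) ->
  (forall x y, lin (fun c => F x y c)) ->
  tsum (rho b) E =
  \tsum_(x, b0 <- rho b) \tsum_(x1, x2 <- DH x) F x1 x2 b0.
Proof.
move=> EF F1 F2 F3; rewrite (eq_tsum _ EF); symmetry.
exact: rho_coassoc_sum.
Qed.
Lemma rho_comul_sum b (F : H -> B -> B -> W) E :
  (forall x b0, E x b0 = tsum (DB b0) (fun b1 b2 => F x b1 b2)) ->
  (forall y c, lin (fun x => F x y c)) -> (forall x c, lin (fun y => F x y c)) ->
  (forall x y, lin (fun c => F x y c)) ->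
  tsum (rho b) E =
  \tsum_(b1, b2 <- DB b) \tsum_(x, b10 <- rho b1) \tsum_(y, b20 <- rho b2)
      F (x * y) b10 b20.
Proof.
move=> EF F1 F2 F3; rewrite (eq_tsum _ EF).
have := congr1 (fun t : H \ox (B \ox B) =>
  tsum t (fun a s => tsum s (fun b c => F a b c))) (adm_comodule_coalgebra HP b).
by move=> R; etransitivity; [|etransitivity; [exact: R|]]; [symmetry|]; flatten.
Qed.

Lemma rho_counitH_sum b (F : k -> B -> W) E :
  (forall x b0, E x b0 = F (eH x) b0) ->
  (forall c, lin (U := k^o) (fun a => F a c)) -> (forall a, lin (fun c => F a c)) ->
  tsum (rho b) E = F 1 b.
Proof.
move=> EF F1 F2; rewrite (eq_tsum _ EF).
rewrite -{2}(coact_counit (adm_comodule HP) b) (lin_sum _ _ (F2 1)); apply: eq_tsum => x y.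
by rewrite (linZ (F2 1)) -(linZ (F1 y)) [_ *: _]mulr1.
Qed.

Lemma rho_colinear_sum (g : B -> k)
    (gC : forall b, \tsum_(x, b0 <- rho b) g b0 *: x = g b *: 1)
    b (F : H -> k -> W) E :
  (forall x b0, E x b0 = F x (g b0)) ->
  (forall x, lin (U := k^o) (fun a => F x a)) -> (forall a, lin (fun x => F x a)) ->
  tsum (rho b) E = F 1 (g b).
Proof.
move=> EF F1 F2; rewrite (eq_tsum _ EF).
have := congr1 (fun x => F x 1) (gC b).
rewrite (lin_sum _ _ (F2 1)) (linZ (F2 1)) -(linZ (F1 1)) [_ *: 1]mulr1 => <-.
by apply: eq_tsum => x y; rewrite (linZ (F2 1)) -(linZ (F1 x)) [_ *: _]mulr1.
Qed.

(** The compatibility of action and coaction, replacing the coaction of an acted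
    element by the coaction of the element itself. *)
Lemma yetter_drinfeld_sum h b (F : H -> B -> W) E :
  (forall h1 h2, E h1 h2 = tsum (rho (h1 |> b)) (fun x b0 => F (x * h2) b0)) ->
  (forall c, lin (fun x => F x c)) -> (forall x, lin (fun c => F x c)) ->
  tsum (DH h) E =
  \tsum_(h1, h2 <- DH h) \tsum_(x, b0 <- rho b) F (h1 * x) (h2 |> b0).
Proof.
move=> EF F1 F2; rewrite (eq_tsum _ EF).
have := congr1 (fun t => tsum t F) (adm_yetter_drinfeld HP h b).
by move=> R; etransitivity; [|etransitivity; [exact: R|]]; [symmetry|]; flatten.
Qed.

Lemma yetter_drinfeld_sum_rev h b (F : H -> B -> W) E :
  (forall h1 h2, E h1 h2 = tsum (rho b) (fun x b0 => F (h1 * x) (h2 |> b0))) ->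
  (forall c, lin (fun x => F x c)) -> (forall x, lin (fun c => F x c)) ->
  tsum (DH h) E =
  \tsum_(h1, h2 <- DH h) \tsum_(x, b0 <- rho (h1 |> b)) F (x * h2) b0.
Proof.
move=> EF F1 F2; rewrite (eq_tsum _ EF); symmetry.
exact: yetter_drinfeld_sum.
Qed.
End Rules.

Ltac rho_coassoc HP := step
  (first [eapply (rho_coassoc_sum HP) | eapply (rho_coassoc_sum HP (W := _^o))];
  [by_front | solve_lin..]).
Ltac rho_coassoc_rev HP := step
  (first [eapply (rho_coassoc_sum_rev HP) | eapply (rho_coassoc_sum_rev HP (W := _^o))];
  [by_front | solve_lin..]).

Ltac rho_comul HP := step
  (first [eapply (rho_comul_sum HP) | eapply (rho_comul_sum HP (W := _^o))];
  [by_front | solve_lin..]).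
Ltac use_rho_counit HP :=
  etransitivity;
  [first [eapply (rho_counitH_sum HP) | eapply (rho_counitH_sum HP (W := _^o))];
  [by_pattern_left | solve_lin..]
  | cbv beta; reflexivity].
Ltac rho_counit HP := step (use_rho_counit HP).
Ltac use_rho_colinear gC :=
  etransitivity;
  [first [eapply (rho_colinear_sum gC) | eapply (rho_colinear_sum (W := _^o) gC)];
  [by_pattern_right | solve_lin..]
  | cbv beta; reflexivity].
Ltac rho_colinear gC := step (use_rho_colinear gC).

(** The rules that recognise a product [u * v] need it as a subterm, while the
    surrounding product is associated to the left. *)
Ltac isolate u v :=
  to_body ltac:(idtac;
    match goal with |- ?L = _ =>
      match L with
      | context [@GRing.mul _ u v] => idtac
      | context [@GRing.mul _ (@GRing.mul _ ?w u) v] => rewrite -(mulrA w u v)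
      end end; reflexivity).
Ltac isolate_act HP u v :=
  to_body ltac:(idtac;
    match goal with |- ?L = _ =>
      match L with
      | context [act _ u (act _ v ?w)] => rewrite -(act_mul HP u v w)
      | _ => isolate u v
      end end; reflexivity).
Ltac use_yetter_drinfeld HP :=
  first [eapply (yetter_drinfeld_sum HP) | eapply (yetter_drinfeld_sum HP (W := _^o))];
  [let h1 := fresh in let h2 := fresh in intros h1 h2;
   match goal with |- context [coact ?P (act ?P' h1 ?b)] => front (coact P (act P' h1 b)) end;
   let x := fresh in let b0 := fresh in
   match goal with |- @tsum ?R ?U ?V ?W ?t _ = _ =>
     eapply (@eq_tsum R U V W t); intros x b0; cbv beta end;
   etransitivity; [isolate_act HP x h2 | cbv beta];
   match goal with |- ?L = ?F _ b0 =>
     match L with context [@GRing.mul ?R x h2] =>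
     let L' := eval pattern (@GRing.mul R x h2), b0 in L in
     match L' with ?f _ _ => unify F f; reflexivity end end end
  | solve_lin..].
Ltac yetter_drinfeld HP := step (use_yetter_drinfeld HP).

Ltac use_yetter_drinfeld_rev HP :=
  first [eapply (yetter_drinfeld_sum_rev HP) | eapply (yetter_drinfeld_sum_rev HP (W := _^o))];
  [let h1 := fresh in let h2 := fresh in intros h1 h2;
   match goal with |- context [@tsum _ _ _ _ (coact ?P ?b) _] =>
     front (coact P b);
     let x := fresh in let b0 := fresh in
     match goal with |- @tsum ?R ?U ?V ?W ?t _ = _ =>
       eapply (@eq_tsum R U V W t); intros x b0; cbv beta end;
     etransitivity; [isolate h1 x | cbv beta];
     match goal with |- ?L = ?F _ ?e' =>
     match L with context [@GRing.mul ?R h1 x] =>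
     let L' := eval pattern (@GRing.mul R h1 x), e' in L in
     match L' with ?f _ _ => unify F f; reflexivity end end end end
  | solve_lin..].
Ltac yetter_drinfeld_rev HP := step (use_yetter_drinfeld_rev HP).

Section FormRules.
Variables (k : fieldType) (H B : algType k) (P : pair_ops H B).
Variables (W : lmodType k) (s : B \ox B -> k).
Hypothesis sM : yd_morphism2 P s.

Local Notation DH := (comul (coalgH P)).
Local Notation eH := (counit (coalgH P)).
Local Notation "h |> b" := (act P h b) (at level 35, right associativity).
Local Notation rho := (coact P).

(** The two conditions on a morphism, as rules: it absorbs a diagonal action
    into the counit and a codiagonal coaction into the unit. *)
Lemma morphism_act_sum h b c (F : k -> W) E :
  (forall h1 h2, E h1 h2 = F (s ((h1 |> b) \ot (h2 |> c)))) ->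
  lin (U := k^o) F ->
  tsum (DH h) E = F (eH h * s (b \ot c)).
Proof.
by move=> EF Fl; have [_ sH _] := sM; rewrite (eq_tsum _ EF) -(sH h b c) (lin_sum _ _ Fl).
Qed.

Lemma morphism_coact_sum b c (F : k -> H -> W) E :
  (forall x b0, E x b0 = tsum (rho c) (fun y c0 => F (s (b0 \ot c0)) (x * y))) ->
  (forall x, lin (U := k^o) (fun a => F a x)) -> (forall a, lin (F a)) ->
  tsum (rho b) E = F (s (b \ot c)) 1.
Proof.
move=> EF F1 F2; have [_ _ /(_ b c) sC] := sM; rewrite (eq_tsum _ EF).
have FE a x : F a x = F 1 (a *: x).
  by rewrite (linZ (F2 1)) -(linZ (F1 x)) [_ *: _]mulr1.
rewrite [RHS]FE -sC (lin_sum _ _ (F2 1)); apply: eq_tsum => x b0.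
by rewrite (lin_sum _ _ (F2 1)); apply: eq_tsum => y c0; exact: FE.
Qed.
End FormRules.

Ltac use_morphism_act sM :=
  etransitivity;
  [first [eapply (morphism_act_sum sM) | eapply (morphism_act_sum (W := _^o) sM)];
  [let h1 := fresh in let h2 := fresh in intros h1 h2;
   match goal with |- ?L = ?F _ =>
     match L with context [?s (@tens ?R ?U ?V (@act ?k ?H ?B ?P h1 ?b) (@act ?k ?H ?B ?P h2 ?c))] =>
     let L' := eval pattern (s (@tens R U V (@act k H B P h1 b) (@act k H B P h2 c))) in L in
     match L' with ?f _ => unify F f; reflexivity end end end |solve_lin..]
  | cbv beta; reflexivity].

(** The sum to be contracted usually surrounds the sums that its summand needs,
    so it is moved inwards before the rule is tried. *)
Ltac morphism_act sM :=
  step (etransitivity; [sink | cbv beta; anywhere ltac:(use_morphism_act sM)]).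

Ltac use_morphism_coact sM :=
  etransitivity;
  [first [eapply (morphism_coact_sum sM) | eapply (morphism_coact_sum (W := _^o) sM)];
  [let x := fresh in let b0 := fresh in intros x b0;
   match goal with |- context [@tsum _ _ _ _ (coact ?P ?c) _] =>
     front (coact P c);
     let y := fresh in let c0 := fresh in
     match goal with |- @tsum ?R ?U ?V ?W ?t _ = _ =>
       eapply (@eq_tsum R U V W t); intros y c0; cbv beta end;
     etransitivity; [isolate x y | cbv beta];
     match goal with |- ?L = ?F (?s _) _ =>
     match L with context [@GRing.mul ?R x y] =>
     match L with context [s (@tens ?R' ?U ?V b0 c0)] =>
     let L' := eval pattern (s (@tens R' U V b0 c0)), (@GRing.mul R x y) in L in
     match L' with ?f _ _ => unify F f; reflexivity end end end end end
  | solve_lin..]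
  | cbv beta; reflexivity].

Ltac morphism_coact sM :=
  step (etransitivity; [sink | cbv beta; anywhere ltac:(first
    [ use_morphism_coact sM
    | match goal with |- context [@tsum _ _ _ _ (coact ?P ?b) _] =>
        etransitivity; [pull (coact P b) | cbv beta; use_morphism_coact sM] end ])]).

(** * The Radford biproduct *)

Section Biproduct.
Variables (k : fieldType) (H B : algType k) (P : pair_ops H B).
Hypothesis HP : is_admissible P.

Local Notation DH := (comul (coalgH P)).
Local Notation eH := (counit (coalgH P)).
Local Notation DB := (comul (coalgB P)).
Local Notation eB := (counit (coalgB P)).
Local Notation "h |> b" := (act P h b) (at level 35, right associativity).
Local Notation rho := (coact P).

Let HB := adm_bialgebraH HP.
Let Hc := admH HP.
Let Bc := admB HP.
Let DHl := comul_lin Hc.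
Let DBl := comul_lin Bc.
Let eHl := counit_lin Hc.
Let eBl := counit_lin Bc.
Let al := act_linl HP.
Let ar := act_linr HP.
Let rl := rho_lin HP.

Lemma biprod_comul b h : comul (biprod_coalg P) (b \ot h) =
  \tsum_(b1, b2 <- DB b) \tsum_(h1, h2 <- DH h)
       \tsum_(x, b20 <- rho b2) (b1 \ot (x * h1)) \ot (b20 \ot h2).
Proof. rewrite /=; flatten. Qed.
Lemma biprod_counit b h : counit (biprod_coalg P) (b \ot h) = eB b * eH h.
Proof. rewrite /=; flatten. Qed.
Lemma biprod_comul_lin : lin (comul (biprod_coalg P)).
Proof. rewrite /=; solve_lin. Qed.
Lemma biprod_counit_lin : slin (counit (biprod_coalg P)).
Proof. rewrite /=; solve_lin. Qed.
Let Kl := biprod_comul_lin.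
Let kl := biprod_counit_lin.

Let eH1 : eH 1 = 1 := counit1 HB.
Let eHM (x y : H) : eH (x * y) = eH x * eH y. Proof. exact (counitM HB x y). Qed.
Let DHM := comulM HB.

(** For coassociativity, with [b] comultiplied into three factors: on one side
    the [H]-part of the coaction of the second and third factors is a product,
    since the coaction is compatible with the comultiplication of [B]; on the
    other side it comes from coassociativity of the coaction. *)
Lemma biprod_coalgebra : is_coalgebra (biprod_coalg P).
Proof.
split; [exact: Kl|exact: kl| | |].
- apply: tensor_eq; [by solve_lin|by solve_lin|] => b h; rewrite biprod_comul.
  expand. rewrite_in biprod_comul. expand. rewrite_in DHM. expand.
  symmetry.
  expand. rewrite_in biprod_comul. expand.
  rho_comul HP.
  symmetry.
  coassoc Hc. coassoc Bc. rho_coassoc HP.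
  reorder. by rewrite !mulrA.
- apply: tensor_eq; [by solve_lin|by solve_lin|] => b h; rewrite biprod_comul.
  expand. rewrite_in biprod_counit. in_body (rewrite eHM). counit Hc. counit Bc. rho_counit HP.
  by rewrite !mul1r scale1r.
- apply: tensor_eq; [by solve_lin|by solve_lin|] => b h; rewrite biprod_comul.
  expand. rewrite_in biprod_counit. counit Hc. rho_colinear (adm_comodule_counit HP).
  counit Bc.
  by rewrite !mul1r scale1r.
Qed.

Section Smash.
Variable A : alg_ops B.
Hypotheses (Al : forall c, lin (fun b => amul A b c)) (Ar : forall b, lin (amul A b)).

Lemma smash_mulE b h b' h' : amul (smash P A) (b \ot h) (b' \ot h') =
  \tsum_(h1, h2 <- DH h) amul A b (h1 |> b') \ot (h2 * h').
Proof. rewrite /=; flatten. Qed.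
Lemma smash_mull w : lin (fun z => amul (smash P A) z w).
Proof. rewrite /=; solve_lin. Qed.
Lemma smash_mulr z : lin (amul (smash P A) z).
Proof. rewrite /=; solve_lin. Qed.
End Smash.

Let mBl (c : B) : lin (fun b => amul (alg_of B) b c). Proof. exact: lin_mull. Qed.
Let mBr b : lin (amul (alg_of B) b). Proof. exact: lin_mulr. Qed.

Lemma biprod_mulE b h b' h' : amul (biprod_alg P) (b \ot h) (b' \ot h') =
  \tsum_(h1, h2 <- DH h) (b * (h1 |> b')) \ot (h2 * h').
Proof. exact: smash_mulE. Qed.
Let Ml w : lin (fun z => amul (biprod_alg P) z w).
Proof. exact: smash_mull. Qed.
Let Mr z : lin (amul (biprod_alg P) z).
Proof. exact: smash_mulr. Qed.

Let Kc := biprod_coalgebra.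

Lemma biprod_counitM z w : counit (biprod_coalg P) (amul (biprod_alg P) z w) =
  counit (biprod_coalg P) z * counit (biprod_coalg P) w.
Proof.
move: z; apply: tensor_eqk; [by solve_lin|by solve_lin|] => a g.
move: w; apply: tensor_eqk; [by solve_lin|by solve_lin|] => b h.
rewrite biprod_mulE !biprod_counit.
expand. in_body (rewrite biprod_counit (adm_counitM HP) (adm_module_counit HP) eHM).
counit Hc. by rewrite mul1r mulrACA.
Qed.

Lemma biprod_mulA x y z : amul (biprod_alg P) x (amul (biprod_alg P) y z) =
  amul (biprod_alg P) (amul (biprod_alg P) x y) z.
Proof.
move: x; apply: tensor_eq; [by solve_lin|by solve_lin|] => a g.
move: y; apply: tensor_eq; [by solve_lin|by solve_lin|] => b h.
move: z; apply: tensor_eq; [by solve_lin|by solve_lin|] => c l.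
rewrite !biprod_mulE; expand. rewrite_in biprod_mulE. expand.
rewrite_in (adm_module_algebraM HP). expand. symmetry.
expand. rewrite_in biprod_mulE. expand. rewrite_in DHM. expand.
in_body (rewrite ?mulrA ?(actM (adm_module HP))). symmetry.
coassoc Hc. in_body (rewrite ?mulrA). reorder.
Qed.

(** Comultiplying [a (g1 . b) # g2 h] produces the coaction of an element
    [g2 . b2] multiplied by [g3]; the Yetter-Drinfeld condition turns it into
    [g2] times the coaction of [b2], which is what the product of the two
    comultiplications contains.  Coassociativity isolates the factors [g2]
    and [g3]. *)
Lemma biprod_comulM x y : comul (biprod_coalg P) (amul (biprod_alg P) x y) =
  \tsum_(x1, x2 <- comul (biprod_coalg P) x)
  \tsum_(y1, y2 <- comul (biprod_coalg P) y)
    amul (biprod_alg P) x1 y1 \ot amul (biprod_alg P) x2 y2.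
Proof.
move: x; apply: tensor_eq; [by solve_lin|by solve_lin|] => a g.
move: y; apply: tensor_eq; [by solve_lin|by solve_lin|] => b h.
rewrite biprod_mulE !biprod_comul; expand. rewrite_in biprod_comul. expand.
rewrite_in (adm_comulM HP). expand. rewrite_in (adm_module_coalgebra HP). expand.
rewrite_in DHM. expand. rewrite_in (adm_comodule_algebraM HP). expand.
(* bring the second and third factors of g under one comultiplication *)
coassoc Hc. within (DH g) ltac:(use_coassoc_rev Hc).
in_body (rewrite ?mulrA). front (DB b). yetter_drinfeld HP. within (DH g) ltac:(use_coassoc Hc).
symmetry. expand. in_body (rewrite !biprod_mulE). expand.
rewrite_in DHM. expand.
coassoc Hc. rho_coassoc HP. in_body (rewrite ?mulrA ?(actM (adm_module HP))). symmetry.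
reorder. by rewrite !mulrA.
Qed.

Theorem biprod_bialg : is_bialg_ops (biprod_alg P) (biprod_coalg P).
Proof.
split=> //.
- exact: biprod_mulA.
- apply: tensor_eq; [by solve_lin|by solve_lin|] => b h; rewrite biprod_mulE.
  rewrite (comul1 HB). expand.
  by rewrite (act1 (adm_module HP)) !mul1r.
- apply: tensor_eq; [by solve_lin|by solve_lin|] => b h; rewrite biprod_mulE.
  rewrite_in (adm_module_algebra1 HP). counit Hc.
  by rewrite scale1r !mulr1.
- rewrite [aone _]/(1 \ot 1) biprod_comul (comul1 HB) (adm_comul1 HP). expand.
  rewrite (adm_comodule_algebra1 HP). expand. by rewrite mulr1.
- by rewrite [aone _]/(1 \ot 1) biprod_counit (adm_counit1 HP) eH1 mulr1.
- exact: biprod_comulM.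
exact: biprod_counitM.
Qed.

Local Notation KA := (biprod_alg P).
Local Notation KD := (biprod_coalg P).
Local Notation KD2 := (tensor_coalg KD KD).

Let Kb := biprod_bialg.
Let aM := act_mul HP.

Implicit Types (s t : B \ox B -> k).

(** * Extension of 2-forms to the biproduct *)

Lemma bar2_lin s : slin s -> slin (bar2 P s).
Proof. by move=> sl; rewrite /bar2; solve_lin. Qed.
Local Hint Resolve bar2_lin : lin.

Lemma bar2E s b h b' h' : slin s ->
  bar2 P s ((b \ot h) \ot (b' \ot h')) = s (b \ot (h |> b')) * eH h'.
Proof. by move=> sl; rewrite /bar2; flatten. Qed.

Lemma tensor22_eqk (f f' : (B \ox H) \ox (B \ox H) -> k) : slin f -> slin f' ->
  (forall b h b' h', f ((b \ot h) \ot (b' \ot h')) = f' ((b \ot h) \ot (b' \ot h'))) ->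
  f = f'.
Proof.
move=> fl fl' ff'; apply/funext; apply: tensor_eqk => // z w.
move: z; apply: tensor_eqk => [||b h]; [by solve_lin|by solve_lin|].
by move: w; apply: tensor_eqk => [||b' h']; [solve_lin|solve_lin|].
Qed.

(** Restriction to elements [b # 1] recovers [s].  Hence identities between
    morphisms in the Yetter-Drinfeld category can be checked on the biproduct. *)
Lemma bar2_inj s t : slin s -> slin t -> bar2 P s = bar2 P t -> s = t.
Proof.
move=> sl tl st; apply/funext; apply: tensor_eqk => // b c.
have := congr1 (fun f => f ((b \ot 1) \ot (c \ot 1))) st.
by rewrite /= !bar2E // eH1 !mulr1 (act1 (adm_module HP)).
Qed.

Lemma yd_conv2_lin s t : slin s -> slin t -> slin (yd_conv2 P s t).
Proof. by move=> sl tl; rewrite /yd_conv2; solve_lin. Qed.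

Lemma yd_conv2E s t b c : slin s -> slin t -> yd_conv2 P s t (b \ot c) =
  \tsum_(b1, b2 <- DB b) \tsum_(c1, c2 <- DB c) \tsum_(x, b20 <- rho b2)
    s (b1 \ot (x |> c1)) * t (b20 \ot c2).
Proof. by move=> sl tl; rewrite /yd_conv2; flatten. Qed.

(** The braiding in the convolution of 2-forms on [B] is the one that the
    comultiplication of the biproduct produces: both sides at
    [a # g] and [b # h] are [s(a1, a2' g1 . b1) t(a2'', g2 . b2) e(h)], with
    [a2'] and [a2''] the two parts of the coaction of [a2]. *)
Lemma bar2_conv s t : slin s -> slin t ->
  bar2 P (yd_conv2 P s t) = conv2 KD (bar2 P s) (bar2 P t).
Proof.
move=> sl tl; have [bsl btl] := (bar2_lin sl, bar2_lin tl).
have stl := yd_conv2_lin sl tl.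
apply: tensor22_eqk => [||a g b h]; first exact: bar2_lin.
  by rewrite (conv2E Kb) //; apply: conv1_lin => //; exact: tensor_coalgebra.
rewrite bar2E // yd_conv2E // /conv2.
rewrite (adm_module_coalgebra HP); expand; symmetry.
expand. rewrite_in biprod_comul. expand. rewrite_in biprod_comul. expand.
in_body (rewrite (bar2E _ _ _ _ sl) (bar2E _ _ _ _ tl) eHM aM).
rho_counit HP. counit Hc.
reorder. by rewrite mul1r !mulr1 mulrA.
Qed.

Lemma bar2_counit : bar2 P (counit2 (coalgB P)) = counit2 KD.
Proof.
have el : slin (counit2 (coalgB P)) by rewrite /counit2; solve_lin.
apply: tensor22_eqk => [||a g b h]; first exact: bar2_lin.
  by rewrite /counit2; solve_lin.
rewrite bar2E // !counit2E !tensor_counit // ?biprod_counit.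
by rewrite (adm_module_counit HP) !mulrA.
Qed.

Lemma bar2_inverse s s' : slin s -> yd_conv2_inverse P s s' ->
  conv2_inverse KD (bar2 P s) (bar2 P s').
Proof.
move=> sl [[sl' _ _] ss' s's]; split; first exact: bar2_lin.
  by rewrite -bar2_conv // ss' bar2_counit.
by rewrite -bar2_conv // s's bar2_counit.
Qed.

Lemma yd_twist_mulE s b c : amul (yd_twist_alg P s) b c =
  \tsum_(b1, b2 <- DB b) \tsum_(c1, c2 <- DB c) \tsum_(x, b20 <- rho b2)
         s (b1 \ot (x |> c1)) *: (b20 * c2).
Proof. by []. Qed.

Lemma twist_mulE (t : (B \ox H) \ox (B \ox H) -> k) z w :
  amul (twist_alg KA KD t) z w =
  \tsum_(x1, x2 <- comul KD z) \tsum_(y1, y2 <- comul KD w)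
     t (x1 \ot y1) *: amul KA x2 y2.
Proof. by []. Qed.

(** Both products of [a # g] and [b # h] are
    [s(a1, a2' g1 . b1) a2'' (g2 . b2) # g3 h], with [a2'] and [a2''] the two
    parts of the coaction of [a2]. *)
Lemma smash_twist s : slin s ->
  smash P (yd_twist_alg P s) = twist_alg KA KD (bar2 P s).
Proof.
move=> sl; have bl := bar2_lin sl.
have tml c : lin (fun b => amul (yd_twist_alg P s) b c) by rewrite /=; solve_lin.
have tmr b : lin (amul (yd_twist_alg P s) b) by rewrite /=; solve_lin.
have sml := smash_mull tml tmr; have smr := smash_mulr tmr.
suff E z w : amul (smash P (yd_twist_alg P s)) z w =
             amul (twist_alg KA KD (bar2 P s)) z w.
  by congr AlgOps; apply/funext => z; apply/funext => w; exact: E.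
rewrite twist_mulE; move: z; apply: tensor_eq; [by solve_lin|by solve_lin|] => a g.
move: w; apply: tensor_eq; [by solve_lin|by solve_lin|] => b h.
rewrite smash_mulE //. rewrite_in yd_twist_mulE. rewrite_in (adm_module_coalgebra HP). expand.
coassoc Hc. in_body (rewrite tensZl).
symmetry. rewrite_in biprod_comul. expand. rewrite_in biprod_comul. expand.
in_body (rewrite (bar2E _ _ _ _ sl) eHM biprod_mulE aM). expand.
rho_counit HP. counit Hc.
reorder. by rewrite !mul1r mulr1.
Qed.

Lemma bar2_normalized s : slin s -> normalized2 (alg_of B) (coalgB P) s ->
  normalized2 KA KD (bar2 P s).
Proof.
move=> sl sN z; have bl := bar2_lin sl.
split; move: z; apply: tensor_eqk;
  [by solve_lin|by solve_lin|move=> b h|by solve_lin|by solve_lin|move=> b h].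
  rewrite [aone _]/(1 \ot 1) bar2E // (act1 (adm_module HP)).
  by rewrite biprod_counit (sN b).1.
rewrite [aone _]/(1 \ot 1) bar2E // (adm_module_algebra1 HP).
by rewrite (linZ (lin_comp sl (lin_tensr b))) biprod_counit (sN b).2 eH1 mulr1 [_ *: _]mulrC.
Qed.

Lemma tensor3K_eqk (f f' : B \ox H -> B \ox H -> B \ox H -> k) :
  (forall z w, slin (fun y => f y z w)) -> (forall y w, slin (fun z => f y z w)) ->
  (forall y z, slin (fun w => f y z w)) ->
  (forall z w, slin (fun y => f' y z w)) -> (forall y w, slin (fun z => f' y z w)) ->
  (forall y z, slin (fun w => f' y z w)) ->
  (forall (a : B) (g : H) (b : B) (h : H) (c : B) (l : H),
    f (a \ot g) (b \ot h) (c \ot l) = f' (a \ot g) (b \ot h) (c \ot l)) ->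
  forall y z w, f y z w = f' y z w.
Proof.
move=> f1 f2 f3 f1' f2' f3' ff' y z w.
move: y; apply: tensor_eqk => // a g.
move: z; apply: tensor_eqk => // b h.
by move: w; apply: tensor_eqk => // c l.
Qed.

(** The left side of the cocycle identity on the biproduct at [a # g], [b # h],
    [c # l] is the left side of the identity on [B] at [a], [g1 . b] and
    [g2 . h . c]; this and [bar2_cocycler] show that the two identities are
    equivalent. *)
Lemma bar2_cocyclel s a g b h c l : slin s ->
  \tsum_(x1, x2 <- comul KD (a \ot g)) \tsum_(y1, y2 <- comul KD (b \ot h))
    bar2 P s (x1 \ot y1) * bar2 P s (amul KA x2 y2 \ot (c \ot l)) =
  \tsum_(g1, g2 <- DH g)
  (\tsum_(a1, a2 <- DB a) \tsum_(b1, b2 <- DB (g1 |> b)) \tsum_(x, a20 <- rho a2)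
     s (a1 \ot (x |> b1)) * s ((a20 * b2) \ot (g2 |> h |> c))) * eH l.
Proof.
move=> sl; have bl := bar2_lin sl.
symmetry. expand. rewrite_in (adm_module_coalgebra HP). expand. coassoc Hc. symmetry.
rewrite_in biprod_comul. expand. rewrite_in biprod_comul. expand.
in_body (rewrite biprod_mulE). expand.
in_body (rewrite !(bar2E _ _ _ _ sl) eHM !aM). counit Hc. rho_counit HP.
reorder. by rewrite !mulr1 mulrA.
Qed.

(** On the side of [B], the coaction of [g2 . b2] appears; the Yetter-Drinfeld
    condition moves [g2] out of it, and [g1], [g2] are then absorbed by the
    [H]-linearity of [s]. *)
Lemma bar2_cocycler s a g b h c l : yd_morphism2 P s ->
  \tsum_(y1, y2 <- comul KD (b \ot h)) \tsum_(z1, z2 <- comul KD (c \ot l))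
    bar2 P s (y1 \ot z1) * bar2 P s ((a \ot g) \ot amul KA y2 z2) =
  \tsum_(g1, g2 <- DH g)
  (\tsum_(b1, b2 <- DB (g1 |> b)) \tsum_(c1, c2 <- DB (g2 |> h |> c))
   \tsum_(x, b20 <- rho b2) s (b1 \ot (x |> c1)) * s (a \ot (b20 * c2))) * eH l.
Proof.
move=> sM; have [sl sH sR] := sM; have bl := bar2_lin sl; symmetry.
expand. rewrite_in (adm_module_coalgebra HP). expand. rewrite_in (adm_module_coalgebra HP). expand.
rewrite_in (adm_module_coalgebra HP). expand. coassoc Hc.
(* bring the second and third factors of g under one comultiplication *)
within (DH g) ltac:(use_coassoc_rev Hc). front (DB b). yetter_drinfeld HP. in_body (rewrite aM).
(* then the first and second ones, which act diagonally on the arguments of s *)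
within (DH g) ltac:(use_coassoc Hc). step (use_coassoc_rev Hc).
morphism_act sM. counit Hc.
symmetry. rewrite_in biprod_comul. expand. rewrite_in biprod_comul. expand.
in_body (rewrite biprod_mulE). expand.
in_body (rewrite !(bar2E _ _ _ _ sl) !eHM ?aM).
rewrite_in (adm_module_algebraM HP). expand.
counit Hc. rho_counit HP. counit Hc.
reorder. by rewrite !mul1r !mulr1 mulrA.
Qed.

Lemma bar2_cocycleE s : yd_morphism2 P s ->
  normalized_left_cocycle KA KD (bar2 P s) <-> yd_normalized_left_cocycle P s.
Proof.
move=> sM; have [sl sH sR] := sM; have bl := bar2_lin sl; split.
  move=> [_ bN bC]; split=> //.
    move=> b; have [] := bN (b \ot 1).
    rewrite [aone KA]/(1 \ot 1) !bar2E // biprod_counit eH1 !mulr1.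
    by rewrite !(act1 (adm_module HP)).
  move=> a b c; have := bC (a \ot 1) (b \ot 1) (c \ot 1).
  rewrite bar2_cocyclel // bar2_cocycler // (comul1 HB).
  rewrite !(@tsum_pure k H H k^o); try by solve_lin.
  by rewrite !(act1 (adm_module HP)) eH1 !mulr1.
move=> [_ sN sC]; split=> //; first exact: bar2_normalized.
apply: tensor3K_eqk; try by solve_lin.
move=> a g b h c l; rewrite bar2_cocyclel // bar2_cocycler //.
by apply: eq_tsum => g1 g2; rewrite sC.
Qed.

Lemma bar2_lazyl s a g b h : slin s ->
  \tsum_(x1, x2 <- comul KD (a \ot g)) \tsum_(y1, y2 <- comul KD (b \ot h))
    bar2 P s (x1 \ot y1) *: amul KA x2 y2 =
  \tsum_(g1, g2 <- DH g)
  (\tsum_(b1, b2 <- DB a) \tsum_(c1, c2 <- DB (g1 |> b)) \tsum_(x, b20 <- rho b2)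
    s (b1 \ot (x |> c1)) *: (b20 * c2)) \ot (g2 * h).
Proof.
move=> sl.
transitivity (amul (smash P (yd_twist_alg P s)) (a \ot g) (b \ot h)).
  by rewrite smash_twist.
by rewrite smash_mulE // => c; rewrite /=; solve_lin.
Qed.

(** The Yetter-Drinfeld condition is used from right to left, to create a
    codiagonal coaction on the arguments of [s], which its colinearity
    removes. *)
Lemma bar2_lazyr s a g b h : yd_morphism2 P s ->
  \tsum_(x1, x2 <- comul KD (a \ot g)) \tsum_(y1, y2 <- comul KD (b \ot h))
    bar2 P s (x2 \ot y2) *: amul KA x1 y1 =
  \tsum_(g1, g2 <- DH g)
  (\tsum_(b1, b2 <- DB a) \tsum_(c1, c2 <- DB (g1 |> b)) \tsum_(x, b20 <- rho b2)
    s (b20 \ot c2) *: (b1 * (x |> c1))) \ot (g2 * h).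
Proof.
move=> sM; have [sl _ _] := sM; have bl := bar2_lin sl; symmetry.
expand. rewrite_in (adm_module_coalgebra HP). expand. coassoc Hc.
in_body (rewrite tensZl). symmetry.
rewrite_in biprod_comul. expand. rewrite_in biprod_comul. expand.
in_body (rewrite (bar2E _ _ _ _ sl) biprod_mulE). expand.
rewrite_in DHM. expand. coassoc Hc. counit Hc. rho_coassoc HP.
in_body (rewrite ?mulrA ?aM). front (DB b).
yetter_drinfeld_rev HP. in_body (rewrite ?mulrA). morphism_coact sM.
reorder. by rewrite mulr1 mul1r.
Qed.

(** From the biproduct to [B]: take [g = h = 1] and apply the counit of [H]. *)
Lemma bar2_lazyE s : yd_morphism2 P s ->
  lazy2 KA KD (bar2 P s) <-> yd_lazy2 P s.
Proof.
move=> sM; have [sl _ _] := sM; have bl := bar2_lin sl; split=> [bL b c|sL z w].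
  have := bL (b \ot 1) (c \ot 1); rewrite bar2_lazyl // bar2_lazyr // (comul1 HB).
  rewrite !tsum_pure; try by solve_lin.
  rewrite !(act1 (adm_module HP)) mulr1.
  move=> /(congr1 (tproj1 (coalgH P))).
  by rewrite !(tproj1E Hc) eH1 !scale1r.
move: z; apply: tensor_eq; [by solve_lin|by solve_lin|] => a g.
move: w; apply: tensor_eq; [by solve_lin|by solve_lin|] => b h.
rewrite bar2_lazyl // bar2_lazyr //.
by apply: eq_tsum => g1 g2; rewrite sL.
Qed.

(** * Morphisms in the Yetter-Drinfeld category *)

(** Linearity needs the Yetter-Drinfeld condition to separate the actions on the
    arguments of [s] and of [t]; for colinearity it is used backwards, to give the
    arguments of [s] a codiagonal coaction. *)
Lemma yd_conv2_morphism s t : yd_morphism2 P s -> yd_morphism2 P t ->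
  yd_morphism2 P (yd_conv2 P s t).
Proof.
move=> sM tM; have [[sl _ _] [tl _ _]] := (sM, tM).
have stl := yd_conv2_lin sl tl; split=> // [h b c|b c].
  rewrite_in (yd_conv2E _ _ sl tl). expand. rewrite_in (adm_module_coalgebra HP). expand.
  rewrite_in (adm_module_coalgebra HP). expand. coassoc Hc.
  (* bring the second and third factors of h under one comultiplication *)
  within (DH h) ltac:(use_coassoc_rev Hc). front (DB b). yetter_drinfeld HP. in_body (rewrite ?aM).
  within (DH h) ltac:(use_coassoc Hc). step (use_coassoc_rev Hc).
  morphism_act sM. morphism_act tM. counit Hc.
  symmetry. rewrite (yd_conv2E _ _ sl tl). expand. reorder.
  by rewrite mul1r mulrCA.
rewrite_in (yd_conv2E _ _ sl tl). expand. in_body (rewrite ?scalerA).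
rho_comul HP. rho_comul HP. rho_coassoc_rev HP. in_body (rewrite ?mulrA).
front (DB c).
yetter_drinfeld_rev HP. in_body (rewrite ?mulrA).
morphism_coact sM. rho_coassoc HP. morphism_coact tM.
rewrite (yd_conv2E _ _ sl tl). symmetry. expand. reorder. by rewrite mulr1.
Qed.

Definition prod_form (g f : B -> k) : B \ox B -> k :=
  fun z => \tsum_(b, c <- z) g b * f c.
Definition mul_form (g : B -> k) : B \ox B -> k :=
  fun z => \tsum_(b, c <- z) g (b * c).

Lemma prod_formE (g f : B -> k) b c : slin g -> slin f ->
  prod_form g f (b \ot c) = g b * f c.
Proof. by move=> gl fl; rewrite /prod_form; flatten. Qed.
Lemma mul_formE (g : B -> k) b c : slin g -> mul_form g (b \ot c) = g (b * c).
Proof. by move=> gl; rewrite /mul_form; flatten. Qed.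

Lemma prod_form_morphism g f : yd_morphism1 P g -> yd_morphism1 P f ->
  yd_morphism2 P (prod_form g f).
Proof.
move=> [gl gH gR] [fl fH fR].
have pl : slin (prod_form g f) by rewrite /prod_form; solve_lin.
split=> // [h b c|b c].
  in_body (rewrite (prod_formE _ _ gl fl) gH fH). counit Hc.
  by rewrite prod_formE // mul1r mulrCA.
in_body (rewrite (prod_formE _ _ gl fl)). rho_colinear fR. rho_colinear gR.
by rewrite prod_formE // mulr1.
Qed.

Lemma mul_form_morphism g : yd_morphism1 P g -> yd_morphism2 P (mul_form g).
Proof.
move=> [gl gH gR].
have pl : slin (mul_form g) by rewrite /mul_form; solve_lin.
split=> // [h b c|b c].
  in_body (rewrite (mul_formE _ _ gl)).
  rewrite mul_formE // -gH (adm_module_algebraM HP). symmetry. expand. done.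
in_body (rewrite (mul_formE _ _ gl)).
rewrite mul_formE // -gR (adm_comodule_algebraM HP). symmetry. expand. done.
Qed.

(** A product in the Yetter-Drinfeld category, which makes [D1] of a morphism a
    morphism; the braiding disappears by linearity of [g]. *)
Lemma yd_D1E g g' : yd_morphism1 P g -> conv1_inverse (coalgB P) g g' ->
  yd_D1 P g = yd_conv2 P (prod_form g g) (mul_form g').
Proof.
move=> [gl gH gR] gg'; have [gl' _ _] := gg'.
have pl : slin (prod_form g g) by rewrite /prod_form; solve_lin.
have ml : slin (mul_form g') by rewrite /mul_form; solve_lin.
have yl := yd_conv2_lin pl ml.
rewrite /yd_D1 /D1 (conv1_invE Bc gl gg').
apply/funext; apply: tensor_eqk; [by rewrite /=; solve_lin|by solve_lin|] => b c.
rewrite yd_conv2E //. symmetry.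
in_body (rewrite (prod_formE _ _ gl gl) (mul_formE _ _ gl') gH).
rho_counit HP. symmetry. expand. reorder. by rewrite mul1r.
Qed.

Lemma bar1_lin g : slin g -> slin (bar1 P g).
Proof. by move=> gl; rewrite /bar1; solve_lin. Qed.
Lemma bar1E g b h : slin g -> bar1 P g (b \ot h) = g b * eH h.
Proof. by move=> gl; rewrite /bar1; flatten. Qed.

Lemma bar1_conv g f : slin g -> slin f ->
  bar1 P (conv1 (coalgB P) g f) = conv1 KD (bar1 P g) (bar1 P f).
Proof.
move=> gl fl; have [bg bf] := (bar1_lin gl, bar1_lin fl).
have cl := conv1_lin Bc gl fl; have bcl := bar1_lin cl.
have ccl := conv1_lin Kc bg bf.
apply/funext; apply: tensor_eqk => // b h.
rewrite bar1E // /conv1 biprod_comul. symmetry. expand.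
in_body (rewrite (bar1E _ _ gl) (bar1E _ _ fl) eHM).
rho_counit HP. counit Hc. symmetry. expand. reorder.
by rewrite mul1r mulr1 mulrA.
Qed.

Lemma bar1_counit : bar1 P eB = counit KD.
Proof.
have bl := bar1_lin eBl.
by apply/funext; apply: tensor_eqk => // b h; rewrite bar1E // biprod_counit.
Qed.

Lemma bar1_inverse g g' : slin g -> conv1_inverse (coalgB P) g g' ->
  conv1_inverse KD (bar1 P g) (bar1 P g').
Proof.
move=> gl [gl' gg' g'g]; split; first exact: bar1_lin.
  by rewrite -bar1_conv // gg' bar1_counit.
by rewrite -bar1_conv // g'g bar1_counit.
Qed.

Lemma bar1_one g : slin g -> bar1 P g (aone KA) = g 1.
Proof. by move=> gl; rewrite [aone _]/(1 \ot 1) bar1E // eH1 mulr1. Qed.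

Lemma bar1_lazy g : yd_morphism1 P g -> lazy1 (coalgB P) g -> lazy1 KD (bar1 P g).
Proof.
move=> [gl gH gR] gL; have bl := bar1_lin gl.
apply: tensor_eq; [by solve_lin|by solve_lin|] => b h.
transitivity ((\tsum_(b1, b2 <- DB b) g b1 *: b2) \ot h).
  rewrite biprod_comul. expand. in_body (rewrite (bar1E _ _ gl) eHM).
  rho_counit HP. counit Hc. symmetry. expand. reorder.
  by rewrite mul1r mulr1 tensZl.
rewrite gL biprod_comul. symmetry. expand. in_body (rewrite (bar1E _ _ gl)).
rho_colinear gR. counit Hc. symmetry. expand. reorder.
by rewrite mul1r mulr1 tensZl.
Qed.

Lemma bar2_prod_form g f : slin g -> yd_morphism1 P f ->
  bar2 P (prod_form g f) =
  conv1 KD2 (bar1 P g \o tproj1 KD) (bar1 P f \o tproj2 KD).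
Proof.
move=> gl [fl fH _]; have [bg bf] := (bar1_lin gl, bar1_lin fl).
have pl : slin (prod_form g f) by rewrite /prod_form; solve_lin.
have [p1 p2] := (cmap_lin (tproj1_cmap Kc Kc), cmap_lin (tproj2_cmap Kc Kc)).
apply: tensor22_eqk => [||a h b l]; first exact: bar2_lin.
  by apply: conv1_lin; [exact: tensor_coalgebra| exact: slin_comp..].
rewrite bar2E // (convTE Kb) // !bar1E // prod_formE // fH.
by rewrite !mulrA.
Qed.

Lemma bar2_mul_form g : slin g ->
  bar2 P (mul_form g) = bar1 P g \o mulT KA.
Proof.
move=> gl; have bg := bar1_lin gl.
have pl : slin (mul_form g) by rewrite /mul_form; solve_lin.
apply: tensor22_eqk => [||a h b l]; first exact: bar2_lin.
  exact: slin_comp bg (mulT_lin Kb).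
rewrite bar2E // /= (mulTE Kb) biprod_mulE mul_formE //.
symmetry. expand. in_body (rewrite (bar1E _ _ gl) eHM). counit Hc.
by rewrite mul1r.
Qed.

Lemma bar2_D1 g g' : yd_morphism1 P g -> conv1_inverse (coalgB P) g g' ->
  bar2 P (yd_D1 P g) = D1T KA KD (bar1 P g) (bar1 P g').
Proof.
move=> gM gg'; have [gl _ _] := gM; have [gl' _ _] := gg'.
have pl : slin (prod_form g g) by rewrite /prod_form; solve_lin.
have ml : slin (mul_form g') by rewrite /mul_form; solve_lin.
rewrite (yd_D1E gM gg') bar2_conv // (conv2E Kb); try exact: bar2_lin.
by rewrite bar2_prod_form // bar2_mul_form.
Qed.

Let K2c : is_coalgebra KD2 := tensor_coalgebra Kc Kc.
Let bl2 := bar2_lin.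

(** * Groups of lazy cocycles and coboundaries of B *)

Lemma morphism_lin s : yd_morphism2 P s -> slin s. Proof. by case. Qed.
Let mlin := morphism_lin.

Lemma bar2_morphism_inj s t : yd_morphism2 P s -> yd_morphism2 P t ->
  bar2 P s = bar2 P t -> s = t.
Proof. by move=> /mlin sl /mlin tl; exact: bar2_inj. Qed.

Lemma bar2M s t : yd_morphism2 P s -> yd_morphism2 P t ->
  bar2 P (yd_conv2 P s t) = conv1 KD2 (bar2 P s) (bar2 P t).
Proof.
move=> /mlin sl /mlin tl; rewrite bar2_conv // (conv2E Kb) //; exact: bl2.
Qed.

Lemma counit_morphism : yd_morphism1 P eB.
Proof.
split=> //; first exact: (adm_module_counit HP).
exact: (adm_comodule_counit HP).
Qed.

Lemma counit2_morphism : yd_morphism2 P (counit2 (coalgB P)).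
Proof. exact: (prod_form_morphism counit_morphism counit_morphism). Qed.

Lemma yd_conv2_inverseE s t : yd_morphism2 P s -> yd_morphism2 P t ->
  yd_conv2_inverse P s t <-> conv1_inverse KD2 (bar2 P s) (bar2 P t).
Proof.
move=> sM tM; have [sl tl] := (mlin sM, mlin tM).
rewrite -(conv2_inverseE Kb _ (bl2 sl)); split; first exact: bar2_inverse.
have stM := yd_conv2_morphism sM tM; have tsM := yd_conv2_morphism tM sM.
have eM := counit2_morphism.
case=> _ st ts; split=> //; apply: bar2_morphism_inj => //;
  by rewrite bar2_conv // bar2_counit.
Qed.

(** Being a normalized lazy cocycle can be tested on the biproduct. *)
Lemma yd_Z2L_E s : yd_Z2L_set P s <->
  [/\ yd_morphism2 P s, yd_conv2_invertible P s & Z2L_set KA KD (bar2 P s)].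
Proof.
split=> [[sC [s' ss'] sL]|[sM si [sC _ sL]]].
  have [sM _ _] := sC; have [s'M _ _] := ss'.
  split=> //; first by exists s'.
  split; [exact/bar2_cocycleE | | exact/bar2_lazyE].
  by exists (bar2 P s'); apply: bar2_inverse => //; exact: mlin.
by split=> //; [exact/bar2_cocycleE | exact/bar2_lazyE].
Qed.

Let ZG := Z2L_group Kb.
Let BC := B2L_central Kb.

Lemma yd_conv2_invertibleM s t : yd_morphism2 P s -> yd_morphism2 P t ->
  yd_conv2_invertible P s -> yd_conv2_invertible P t ->
  yd_conv2_invertible P (yd_conv2 P s t).
Proof.
move=> sM tM [s' ss'] [t' tt']; have [s'M _ _] := ss'; have [t'M _ _] := tt'.
exists (yd_conv2 P t' s').
have M := yd_conv2_morphism.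
apply/yd_conv2_inverseE; [exact: M|exact: M|rewrite !bar2M //].
have sl := mlin sM; have tl := mlin tM.
apply: conv1_inverse_mul => //; [exact: bl2|exact: bl2| |]; exact/yd_conv2_inverseE.
Qed.

(** All laws hold for the images under the injective multiplicative map [bar2],
    which lie in the group of lazy cocycles of the biproduct. *)
Theorem yd_Z2L_group : is_group (yd_Z2L P).
Proof.
have M := yd_conv2_morphism.
have conv s t : yd_morphism2 P s -> yd_morphism2 P t ->
    bar2 P (yd_conv2 P s t) = conv2 KD (bar2 P s) (bar2 P t).
  by move=> /mlin sl /mlin tl; exact: bar2_conv.
have eM := counit2_morphism.
have eZ : Z2L_set KA KD (bar2 P (counit2 (coalgB P))).
  by rewrite bar2_counit; exact: (gone_in ZG).
split=> [|s t|s t u|s|s|s] /=.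
- apply/yd_Z2L_E; split=> //; exists (counit2 (coalgB P)).
  by split=> //; apply: bar2_morphism_inj; rewrite ?conv ?bar2_counit //;
    [exact: M|exact: (gmul1x ZG (gone_in ZG))|exact: M|exact: (gmul1x ZG (gone_in ZG))].
- move=> /yd_Z2L_E[sM si sZ] /yd_Z2L_E[tM ti tZ]; apply/yd_Z2L_E.
  split; [exact: M | exact: yd_conv2_invertibleM |].
  by rewrite conv //; exact: (gmul_in ZG).
- move=> /yd_Z2L_E[sM _ sZ] /yd_Z2L_E[tM _ tZ] /yd_Z2L_E[uM _ uZ].
  have [stM tuM] := (M _ _ sM tM, M _ _ tM uM).
  apply: bar2_morphism_inj; [exact: M|exact: M|rewrite !conv //].
  exact: (gmulA ZG).
- move=> /yd_Z2L_E[sM _ sZ].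
  apply: bar2_morphism_inj => //; [exact: M|rewrite conv // bar2_counit].
  exact: (gmul1x ZG).
- move=> /yd_Z2L_E[sM _ sZ].
  apply: bar2_morphism_inj => //; [exact: M|rewrite conv // bar2_counit].
  exact: (gmulx1 ZG).
move=> /yd_Z2L_E[sM [s' ss'] sZ]; have [s'M E1 E2] := ss'.
exists s' => //; apply/yd_Z2L_E; split=> //; first by exists s; split.
move/(Z2L_E Kb) in sZ; apply/(Z2L_E Kb); apply: (lazy_cocycleV Kb sZ).
exact/yd_conv2_inverseE.
Qed.

Theorem bar2_hom : is_group_hom (yd_Z2L P) (Z2L KA KD) (bar2 P).
Proof.
split=> [||s /yd_Z2L_E[]|s t /yd_Z2L_E[sM _ _] /yd_Z2L_E[tM _ _]] //=.
- exact: yd_Z2L_group.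
by apply: bar2_conv; exact: mlin.
Qed.

Lemma bar2_coboundary s : yd_B2L_set P s -> B2L_set KA KD (bar2 P s).
Proof.
move=> [g [gM g1 [g' g'M gg'] gL ->]]; have [gl _ _] := gM.
apply/(B2L_E Kb); exists (bar1 P g), (bar1 P g'); split.
- exact: bar1_lin.
- by rewrite bar1_one.
- exact: bar1_inverse.
- exact: bar1_lazy.
exact: bar2_D1.
Qed.

Lemma conv1_morphism g f : yd_morphism1 P g -> yd_morphism1 P f ->
  yd_morphism1 P (conv1 (coalgB P) g f).
Proof.
move=> [gl gH gR] [fl fH fR]; have cl := conv1_lin Bc gl fl.
split=> // [h b|b].
  rewrite {1}/conv1 (adm_module_coalgebra HP). expand. in_body (rewrite gH fH).
  counit Hc. symmetry; rewrite /conv1. expand. by apply: eq_tsum => b1 b2; rewrite mul1r mulrCA.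
rewrite /conv1. expand. rho_comul HP.
rho_colinear gR. rho_colinear fR.
symmetry; expand. by apply: eq_tsum => b1 b2; rewrite mulr1.
Qed.
(** Carrying the inverse makes the notion symmetric in [g] and [g']. *)
Definition yd_lazy_unit (g g' : B -> k) : Prop :=
  [/\ yd_morphism1 P g, yd_morphism1 P g', g 1 = 1,
      conv1_inverse (coalgB P) g g' & lazy1 (coalgB P) g].

Lemma yd_B2L_E s : yd_B2L_set P s <->
  exists g g', yd_lazy_unit g g' /\ s = yd_D1 P g.
Proof.
split=> [[g [gM g1 [g' g'M gg'] gL ->]]|[g [g' [[gM g'M g1 gg' gL] ->]]]].
  by exists g, g'.
by exists g; split=> //; exists g'.
Qed.

Lemma yd_lazy_unit1 : yd_lazy_unit eB eB.
Proof.
have eM := counit_morphism.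
split=> //; [exact: (adm_counit1 HP) | exact: conv1_inverse1 |].
by apply/lazy1E; exact: commutes1.
Qed.

Lemma yd_lazy_unitV g g' : yd_lazy_unit g g' -> yd_lazy_unit g' g.
Proof.
move=> [gM g'M g1 gg' gL]; have [[gl _ _] [gl' _ _]] := (gM, g'M).
split=> //; last 1 first.
- by apply/lazy1E; apply: (commutesV Bc gl _ gg') => //; exact/lazy1E.
- rewrite -bar1_one //; apply: (conv1_inverse_one Kb (g := bar1 P g)).
  + exact: bar1_lin.
  + by rewrite bar1_one.
  exact: bar1_inverse.
exact: conv1_inverse_sym.
Qed.

Lemma yd_lazy_unitM g g' f f' : yd_lazy_unit g g' -> yd_lazy_unit f f' ->
  yd_lazy_unit (conv1 (coalgB P) g f) (conv1 (coalgB P) g' f').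
Proof.
move=> gU fU; have [_ _ _ _ fL'] := yd_lazy_unitV fU.
have [gM g'M g1 gg' gL] := gU; have [fM f'M f1 ff' fL] := fU.
have [[gl _ _] [gl' _ _]] := (gM, g'M); have [[fl _ _] [fl' _ _]] := (fM, f'M).
have E : conv1 (coalgB P) g' f' = conv1 (coalgB P) f' g'.
  by symmetry; apply: lazy1_central => //; exact/lazy1E.
split; [exact: conv1_morphism | exact: conv1_morphism | | |].
- rewrite /conv1 (adm_comul1 HP).
  by etransitivity; [flatten|]; rewrite g1 f1 mulr1.
- by rewrite E; exact: conv1_inverse_mul.
by apply/lazy1E; apply: commutesM => //; exact/lazy1E.
Qed.

Lemma yd_D1_morphism g g' : yd_lazy_unit g g' -> yd_morphism2 P (yd_D1 P g).
Proof.
move=> [gM g'M _ gg' _]; rewrite (yd_D1E gM gg').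
by apply: yd_conv2_morphism;
  [exact: prod_form_morphism | exact: mul_form_morphism].
Qed.

(** Transferred from the biproduct, as are the remaining coboundary laws. *)
Lemma yd_D1_mul g g' f f' : yd_lazy_unit g g' -> yd_lazy_unit f f' ->
  yd_conv2 P (yd_D1 P g) (yd_D1 P f) = yd_D1 P (conv1 (coalgB P) g f).
Proof.
move=> gU fU; have gfU := yd_lazy_unitM gU fU.
have [DgM DfM] := (yd_D1_morphism gU, yd_D1_morphism fU).
apply: bar2_morphism_inj; [exact: yd_conv2_morphism | exact: yd_D1_morphism gfU |].
have [gM g'M g1 gg' gL] := gU; have [fM f'M f1 ff' fL] := fU.
have [gfM _ _ gfI _] := gfU.
have [[gl _ _] [gl' _ _]] := (gM, g'M); have [[fl _ _] [fl' _ _]] := (fM, f'M).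
rewrite bar2M // (bar2_D1 gM gg') (bar2_D1 fM ff') (bar2_D1 gfM gfI).
rewrite (D1T_mul Kb); [by rewrite !bar1_conv|exact: bar1_lin| | | |].
- exact: bar1_lin.
- exact: bar1_inverse.
- exact: bar1_inverse.
exact: bar1_lazy.
Qed.

Lemma yd_D1_counit : yd_D1 P eB = counit2 (coalgB P).
Proof.
have [eM _ _ ee _] := yd_lazy_unit1.
apply: bar2_morphism_inj; [exact: yd_D1_morphism yd_lazy_unit1 | exact: counit2_morphism |].
by rewrite (bar2_D1 eM ee) bar1_counit (D1T_counit Kb) bar2_counit.
Qed.

Theorem yd_B2L_central : is_central_subgroup (yd_Z2L P) (yd_B2L_set P).
Proof.
have inv g g' : yd_lazy_unit g g' ->
    yd_conv2 P (yd_D1 P g) (yd_D1 P g') = counit2 (coalgB P).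
  move=> gU; have [_ _ _ [_ E _] _] := gU.
  by rewrite (yd_D1_mul gU (yd_lazy_unitV gU)) E yd_D1_counit.
have sub s : yd_B2L_set P s -> yd_Z2L_set P s.
  move=> sB; apply/yd_Z2L_E; have /yd_B2L_E[g [g' [gU sE]]] := sB.
  have gV := yd_lazy_unitV gU.
  split; [by rewrite sE; exact: yd_D1_morphism gU | |].
    exists (yd_D1 P g'); rewrite sE; split; first exact: yd_D1_morphism gV.
      exact: inv gU.
    exact: inv gV.
  exact: (central_sub BC (bar2_coboundary sB)).
split=> // [|s t|s|s n].
- by apply/yd_B2L_E; exists eB, eB; split; [exact: yd_lazy_unit1 | rewrite yd_D1_counit].
- move=> /yd_B2L_E[g [g' [gU ->]]] /yd_B2L_E[f [f' [fU ->]]].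
  apply/yd_B2L_E; exists (conv1 (coalgB P) g f), (conv1 (coalgB P) g' f').
  by split; [exact: yd_lazy_unitM | exact: (yd_D1_mul gU fU)].
- move=> /yd_B2L_E[g [g' [gU ->]]]; have gV := yd_lazy_unitV gU.
  exists (yd_D1 P g'); first by apply/yd_B2L_E; exists g', g.
  by split; [exact: inv gU | exact: inv gV].
move=> /yd_Z2L_E[sM _ sZ] nB; have /yd_Z2L_E[nM _ _] := sub n nB.
have M := yd_conv2_morphism.
apply: bar2_morphism_inj; [exact: M|exact: M|].
rewrite !bar2_conv; try exact: mlin.
exact: (centralC BC sZ (bar2_coboundary nB)).
Qed.

End Biproduct.

(** * Comparison of lazy cohomology groups *)

Theorem theorem4p4 (k : fieldType) (H B : algType k) (P : pair_ops H B) :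
  is_hopf_admissible P ->
  [/\ forall s, yd_normalized_left_cocycle P s ->
        [/\ normalized_left_cocycle (biprod_alg P) (biprod_coalg P) (bar2 P s),
            smash P (yd_twist_alg P s) =
              twist_alg (biprod_alg P) (biprod_coalg P) (bar2 P s)
          & forall t,
              normalized_left_cocycle (biprod_alg P) (biprod_coalg P) t ->
              smash P (yd_twist_alg P s) =
                twist_alg (biprod_alg P) (biprod_coalg P) t ->
              t = bar2 P s],
      forall s s', yd_normalized_left_cocycle P s -> yd_conv2_inverse P s s' ->
        conv2_inverse (biprod_coalg P) (bar2 P s) (bar2 P s'),
      forall s, yd_normalized_left_cocycle P s -> yd_lazy2 P s ->
        lazy2 (biprod_alg P) (biprod_coalg P) (bar2 P s),
      (forall s t, yd_normalized_left_cocycle P s -> yd_lazy2 P s ->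
         yd_normalized_left_cocycle P t -> yd_lazy2 P t ->
         bar2 P (yd_conv2 P s t) =
           conv2 (biprod_coalg P) (bar2 P s) (bar2 P t)) /\
      is_group_hom (yd_Z2L P) (Z2L (biprod_alg P) (biprod_coalg P)) (bar2 P)
    & (forall g, yd_morphism1 P g -> normalized1 (alg_of B) g ->
         yd_conv1_invertible P g ->
         [/\ scalar (bar1 P g),
             normalized1 (biprod_alg P) (bar1 P g),
             conv1_invertible (biprod_coalg P) (bar1 P g),
             bar2 P (yd_D1 P g) =
               D1 (biprod_alg P) (biprod_coalg P) (bar1 P g)
           & lazy1 (coalgB P) g -> lazy1 (biprod_coalg P) (bar1 P g)]) /\
      (forall s, yd_B2L_set P s ->
         B2L_set (biprod_alg P) (biprod_coalg P) (bar2 P s)) /\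
      (exists f,
         is_group_hom (yd_H2L P) (H2L (biprod_alg P) (biprod_coalg P)) f /\
         forall s, yd_Z2L_set P s ->
           f (coset (yd_Z2L P) (yd_B2L_set P) s) =
           coset (Z2L (biprod_alg P) (biprod_coalg P))
                 (B2L_set (biprod_alg P) (biprod_coalg P)) (bar2 P s))].

Proof.
case=> HP _ _; have Kb := biprod_bialg HP.
have lin2 s : yd_morphism2 P s -> slin s by case.
have coM s : yd_normalized_left_cocycle P s -> yd_morphism2 P s by case.
split=> [s sC|s s' sC|s sC sL||].
- have sl := lin2 s (coM s sC); split.
  + exact/(bar2_cocycleE HP (coM s sC)).
  + exact: (smash_twist HP).
  move=> t [tl _ _] st; apply: (twist_alg_inj Kb tl (bar2_lin HP sl)).
  by rewrite -st (smash_twist HP).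
- by apply: (bar2_inverse HP); exact: lin2 (coM s sC).
- exact/(bar2_lazyE HP (coM s sC)).
- split=> [s t sC _ tC _|]; last exact: (bar2_hom HP).
  by apply: (bar2_conv HP); exact: lin2 (coM _ _).
split=> [g gM g1 [g' g'M gg']|].
  have [gl _ _] := gM; split.
  + exact: (bar1_lin HP).
  + by rewrite /normalized1 (bar1_one HP).
  + by exists (bar1 P g'); exact: (bar1_inverse HP).
  + have bgg' := bar1_inverse HP gl gg'.
    by rewrite (bar2_D1 HP gM gg') (D1E Kb (bar1_lin HP gl) bgg').
  exact: (bar1_lazy HP).
split; first exact: (bar2_coboundary HP).
exact: (quotient_hom (bar2_hom HP) (yd_B2L_central HP) (B2L_central Kb)
  (bar2_coboundary HP)).
Qed.
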